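(* Let $H$ be a separable Hilbert space, let $X$ be an $H$-valued random variable satisfying assumptions (A1) and (A2) given in the context, and let $m$ be its geometric median. Let $\alpha\in(1/2,1)$, $c_\gamma>0$, $\gamma_n=c_\gamma n^{-\alpha}$, and let $(Z_n)_{n\ge 1}$ be the stochastic gradient sequence $$Z_{n+1}=Z_n+\gamma_n\frac{X_{n+1}-Z_n}{\|X_{n+1}-Z_n\|},\qquad n\ge 1,$$ where $X_1,X_2,\dots$ are independent copies of $X$ and $Z_1$ is bounded. Then for all $\beta<\alpha$, $$\|Z_n-m\|=o\left(\frac{1}{n^{\beta/2}}\right)\quad\text{almost surely, as } n\to\infty.$$
   Context: $H$ is a separable Hilbert space (possibly infinite dimensional) with inner product $\langle\cdot,\cdot\rangle$ and norm $\|\cdot\|$. The geometric median of $X$ is $m:=\arg\min_{h\in H}\mathbb{E}[\|X-h\|-\|X\|]$. No moment assumption is made on $X$. Assumptions: (A1) For all $h\in H$ there is $h'\in H$ such that $\langle h,h'\rangle=0$ and $\mathrm{Var}(\langle X,h'\rangle)>0$. (This ensures that $m$ is uniquely defined.) (A2) There is a positive constant $C$ such that for all $h\in H$, $\mathbb{E}[1/\|X-h\|]\le C$ and $\mathbb{E}[1/\|X-h\|^2]\le C$. $X_1,X_2,\dots$ are independent random variables with the same law as $X$. The initialization $Z_1$ is bounded (for instance $Z_1=X_1\mathbf 1_{\{\|X_1\|\le M\}}$ with $M$ a constant) or deterministic; it is measurable with respect to $\sigma(X_1)$. The event $X_{n+1}=Z_n$ has probability zero under (A2). *)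

(* Defs.v *)
From mathcomp Require Import all_boot all_order all_algebra finmap.
From mathcomp Require Import sesquilinear.
From mathcomp Require Import all_classical all_reals all_analysis.

Set Implicit Arguments.
Unset Strict Implicit.
Unset Printing Implicit Defensive.

Import Order.TTheory GRing.Theory Num.Theory.
Import numFieldNormedType.Exports.

Local Open Scope classical_set_scope.
Local Open Scope ring_scope.

(* A real Hilbert space is a complete normed module whose norm is the one
   induced by a positive definite symmetric bilinear form. *)
Definition induces_norm (R : realType) (H : completeNormedModType R)
    (dot : {dot H for (@idfun R)}) : Prop :=
  forall x : H, dot x x = `|x| ^+ 2.

Definition separable (H : topologicalType) : Prop :=
  exists2 D : set H, countable D & dense D.

(* The carrier of H with its Borel sigma-algebra. *)
Notation borel H := (g_sigma_algebraType (@open H)).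

Section probability.
Context (d : measure_display) (T : measurableType d) (R : realType).
Variable P : probability T R.

Section family.
Context (d' : measure_display) (E : measurableType d').

(* Laws are only compared on measurable sets: the value of a measure at a
   non-measurable set is unspecified. *)
Definition same_law (X Y : {RV P >-> E}) : Prop :=
  forall A : set E, measurable A -> distribution P X A = distribution P Y A.

Definition mutually_independent (I : choiceType) (D : set I)
    (X : I -> {RV P >-> E}) : Prop :=
  forall (J : {fset I}) (A : I -> set E),
    [set` J] `<=` D -> (forall i, i \in J -> measurable (A i)) ->
    P (\bigcap_(i in [set` J]) (X i @^-1` A i)) =
      (\prod_(i <- J) P (X i @^-1` A i))%E.

End family.

Section hilbert.
Context (H : completeNormedModType R).

Definition geometric_median (X : T -> H) (m : H) : Prop :=
  forall h : H,
    ('E_P[(fun w => `|X w - m| - `|X w|)%R] <=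
     'E_P[(fun w => `|X w - h| - `|X w|)%R])%E.

(* The library variance takes values in \bar R: a non-constant variable without
   finite second moment has variance +oo, including when its expectation
   is infinite or undefined. *)
Definition assumption_A1 (dot : {dot H for (@idfun R)}) (X : T -> H) : Prop :=
  forall h : H, exists h' : H,
    dot h h' = 0 /\ (0 < 'V_P[(fun w => dot (X w) h')%R])%E.

(* The inverse is taken in \bar R, where 0^-1 = +oo (in R it would be 0). *)
Definition assumption_A2 (X : T -> H) : Prop :=
  exists C : R, 0 < C /\ forall h : H,
    (\int[P]_w (`|X w - h|%R%:E)^-1 <= C%:E)%E /\
    (\int[P]_w ((`|X w - h| ^+ 2)%R%:E)^-1 <= C%:E)%E.

Definition ae_bounded (Y : T -> H) : Prop :=
  exists M : R, {ae P, forall w, `|Y w| <= M}.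

Definition sigma_measurable (X Y : T -> H) : Prop :=
  forall B : set (borel H), measurable B ->
    g_sigma_algebra_preimage (X : T -> borel H) (Y @^-1` B).

(* Where X n.+1 w = Z n w, the step is 0 because 0^-1 = 0 in R and 0 is scaled. *)
Definition stochastic_gradient (gamma : nat -> R) (X Z : nat -> T -> H) : Prop :=
  forall n : nat, (0 < n)%N -> forall w : T,
    Z n.+1 w = Z n w + gamma n *:
      (`|X n.+1 w - Z n w|^-1 *: (X n.+1 w - Z n w)).

End hilbert.
End probability.

(* Main.v *)
Require Import Defs.
From HB Require Import structures.
From mathcomp Require Import all_boot all_order all_algebra finmap.
From mathcomp Require Import sesquilinear ring lra zify.
From mathcomp Require Import all_classical all_reals all_analysis.
From mathcomp Require Import measurable_realfun.

(* For z in the ball of radius A around the median m, let U = (X - z) / |X - z|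
   and Y = X - m.  Convexity of the norm, with its remainder kept, gives
     E <U, z - m> <= - Q (z - m),
     Q u = E [(|u|^2 |Y|^2 - <u, Y>^2) / (2 |Y| (A + |Y|)^2)],
   with no differentiation at m.  Comparing Q at u with Q at an independent copy
   of Y shows that (A1) makes Q coercive, even in infinite dimension.  Hence, as
   long as the iterates stay in the ball, a_n = E |Z_n - m|^(2p) satisfies
     a_(n+1) <= (1 - lambda gamma_n) a_n + C gamma_n^(p+1),
   so a_n = O(n^(- alpha p)).  If p (alpha - beta) >= 2 the series of
   n^(beta p) |Z_n - m|^(2p) has a finite expectation, so its terms tend to 0
   almost surely.  Finally sum gamma_n^2 < oo yields a maximal inequality: the
   iterates leave the ball with probability at most K / A^2, with K independent
   of A. *)

Set Implicit Arguments.
Unset Strict Implicit.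
Unset Printing Implicit Defensive.

Import Order.TTheory GRing.Theory Num.Theory.
Import numFieldNormedType.Exports.

Local Open Scope classical_set_scope.
Local Open Scope ring_scope.

(** * Inner product and Gram determinant *)

(** The form of the weight in [Q] answers two needs. X has no moments, so the integrand must remain
    bounded for large Y. The convexity remainder at z has |X - z| in its denominator, and only a
    triangle inequality valid for z in a ball trades it for |Y|. Hence the radius A, a constant
    lambda that depends on A, and the stopping.

    The unit sphere of H need not be compact, so positivity of [Q u] for every nonzero u would not
    yield lambda. The comparison with an independent copy reduces coercivity to the positivity of
    one number, the expectation of [Q Y] times the weight of Y, in which u no longer occurs.

    High moments are needed because alpha < 1: a second moment of order n^(-alpha) is not summable.
    Stopping keeps all of them finite. The maximal inequality, by contrast, uses the second moment
    only and discards the curvature altogether; this is why its constant does not see lambda, and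
    hence not A. *)

Definition unit_vec (R : realType) (H : normedModType R) (v : H) : H :=
  `|v|^-1 *: v.

Section inner_product.
Context (R : realType) (H : completeNormedModType R).
Context (dot : {dot H for (@idfun R)}) (Hdot : induces_norm dot).
Implicit Types (a b u x y z : H) (k : R).

Lemma dotC x y : dot x y = dot y x.
Proof. by have := @hermC _ _ _ _ dot x y; rewrite expr0 mul1r. Qed.

Lemma dotDl x y z : dot (x + y) z = dot x z + dot y z.
Proof. exact: linearDl. Qed.

Lemma dotNl x z : dot (- x) z = - dot x z.
Proof. exact: linearNl. Qed.

Lemma dotZl k x z : dot (k *: x) z = k * dot x z.
Proof. exact: (linearZl_LR dot z k x). Qed.

Lemma dotDr x y z : dot z (x + y) = dot z x + dot z y.
Proof. by rewrite dotC dotDl !(dotC z). Qed.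

Lemma dotNr x z : dot z (- x) = - dot z x.
Proof. by rewrite dotC dotNl (dotC z). Qed.

Lemma dotZr k x z : dot z (k *: x) = k * dot z x.
Proof. by rewrite dotC dotZl (dotC z). Qed.

Definition dotE := (dotDl, dotDr, dotNl, dotNr, dotZl, dotZr).

Lemma dot_normD x y : `|x + y| ^+ 2 = `|x| ^+ 2 + 2 * dot x y + `|y| ^+ 2.
Proof. rewrite -!Hdot !dotE (dotC y x); ring. Qed.

Lemma dot_polarization x y :
  dot x y = (`|x + y| ^+ 2 - `|x| ^+ 2 - `|y| ^+ 2) / 2.
Proof. rewrite dot_normD; lra. Qed.

Definition gram x y : R := `|x| ^+ 2 * `|y| ^+ 2 - dot x y ^+ 2.

Lemma gram_ge0 x y : 0 <= gram x y.
Proof.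
have [->|y0] := eqVneq y 0.
  rewrite /gram normr0 expr0n mulr0 sub0r.
  have -> : dot x 0 = 0 by rewrite -(scale0r (0 : H)) dotZr mul0r.
  by rewrite expr0n oppr0.
have q0 : 0 < `|y| ^+ 2 by rewrite exprn_gt0// normr_gt0.
have : 0 <= `|(`|y| ^+ 2) *: x - dot x y *: y| ^+ 2 by exact: exprn_ge0.
rewrite -[X in 0 <= X]Hdot !dotE !(dotC y x) !Hdot => h.
rewrite -(pmulr_rge0 _ q0) /gram.
by apply: le_trans h _; rewrite le_eqVlt; apply/orP; left; apply/eqP; ring.
Qed.

Lemma dot_le_norm x y : dot x y <= `|x| * `|y|.
Proof.
have := gram_ge0 x y; rewrite /gram subr_ge0 -exprMn => h.
rewrite -[dot x y]/(dot x y) (le_trans (ler_norm _))//.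
by rewrite -ler_sqr ?nnegrE ?mulr_ge0// real_normK ?num_real.
Qed.

Lemma gram_le x y : gram x y <= `|x| ^+ 2 * `|y| ^+ 2.
Proof. by rewrite /gram gerBl sqr_ge0. Qed.

Lemma gramC x y : gram x y = gram y x.
Proof. by rewrite /gram dotC mulrC. Qed.

Lemma gramNr x y : gram x (- y) = gram x y.
Proof. by rewrite /gram dotNr normrN sqrrN. Qed.

Lemma gramBl a b : gram (a - b) b = gram a b.
Proof. rewrite /gram -!Hdot !dotE !(dotC b a); ring. Qed.

(* If u is nearly parallel to x, it cannot be nearly parallel to y as well, unless
   x and y are nearly parallel. *)
Lemma gram_sum u x y :
  2^-1 * (`|u| ^+ 2 * gram x y) <= `|x| ^+ 2 * gram u y + `|y| ^+ 2 * gram u x.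
Proof.
rewrite /gram.
(* The test vector is chosen so that its product with [u] is [s = a^2 q^2 + b^2 p^2]. Cauchy-Schwarz
   bounds [s^2], the mixed term is again at most a multiple of [s], and dividing by [s] gives
   [s <= n^2 (3 p^2 q^2 + c^2) / 2], which is the claim rearranged. *)
have := gram_ge0 u ((dot u x * `|y| ^+ 2) *: x + (dot u y * `|x| ^+ 2) *: y).
rewrite /gram -[in X in _ * X]Hdot !dotE !(dotC y x) !Hdot.
have := gram_ge0 x y; rewrite /gram.
set a := dot u x; set b := dot u y; set c := dot x y.
have := normr_ge0 u; have := normr_ge0 x; have := normr_ge0 y.
set n := `|u|; set p := `|x|; set q := `|y| => q0 p0 n0 hc h.
have [pq0|] := eqVneq (p * q) 0.
  have pq2 : p ^+ 2 * q ^+ 2 = 0 by rewrite -exprMn pq0 expr0n.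
  have /eqP c0 : c == 0.
    by rewrite -sqrf_eq0 eq_le sqr_ge0 andbT; move: hc; rewrite pq2; lra.
  rewrite pq2 c0 expr0n subr0 mulr0 mulr0.
  by apply: addr_ge0; apply: mulr_ge0 (sqr_ge0 _) _; exact: gram_ge0.
move=> pqn0; have pq : 0 < p * q by rewrite lt_def pqn0 mulr_ge0.
set s := a ^+ 2 * q ^+ 2 + b ^+ 2 * p ^+ 2.
have s0 : 0 <= s by rewrite addr_ge0// mulr_ge0// sqr_ge0.
have h1 : s ^+ 2 <= n ^+ 2 * ((p * q) ^+ 2 * s + 2 * (a * b * c) * (p * q) ^+ 2).
  move: h; rewrite /s; lra.
have h2 : 2 * `|a * b| * (p * q) <= s.
  have := sqr_ge0 (`|a| * q - `|b| * p).
  rewrite normrM sqrrB !exprMn !real_normK ?num_real// /s; lra.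
have h3 : `|c| * (p * q) <= ((p * q) ^+ 2 + c ^+ 2) / 2.
  have := sqr_ge0 (p * q - `|c|); rewrite sqrrB real_normK ?num_real//; lra.
have h4 : 2 * (a * b * c) * (p * q) ^+ 2 <= s * (((p * q) ^+ 2 + c ^+ 2) / 2).
  apply: le_trans (_ : (2 * `|a * b| * (p * q)) * (`|c| * (p * q)) <= _).
    have := ler_norm (a * b * c); rewrite (normrM _ c) => h4.
    have -> : 2 * `|a * b| * (p * q) * (`|c| * (p * q))
      = 2 * (`|a * b| * `|c|) * (p * q) ^+ 2 by ring.
    by rewrite ler_wpM2r ?sqr_ge0// ler_wpM2l.
  by rewrite ler_pM// !mulr_ge0// ltW.
have [s_eq0|sn0] := eqVneq s 0; last first.
  have sp : 0 < s by rewrite lt_def sn0.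
  have : s <= n ^+ 2 * ((p * q) ^+ 2 + ((p * q) ^+ 2 + c ^+ 2) / 2).
    rewrite -(ler_pM2r sp) -expr2; apply: le_trans h1 _.
    by rewrite -[leRHS]mulrA ler_wpM2l ?sqr_ge0// [leRHS]mulrDl lerD2l [leRHS]mulrC.
  rewrite /s !exprMn; lra.
have a0 : a ^+ 2 * q ^+ 2 = 0.
  have := mulr_ge0 (sqr_ge0 b) (sqr_ge0 p).
  have := mulr_ge0 (sqr_ge0 a) (sqr_ge0 q).
  by move: s_eq0; rewrite /s; lra.
have b0 : b ^+ 2 * p ^+ 2 = 0 by move: s_eq0; rewrite /s a0; lra.
have := mulr_ge0 (sqr_ge0 n) hc.
have := mulr_ge0 (sqr_ge0 n) (sqr_ge0 c).
have -> : p ^+ 2 * (n ^+ 2 * q ^+ 2 - b ^+ 2)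
    + q ^+ 2 * (n ^+ 2 * p ^+ 2 - a ^+ 2) = 2 * (n ^+ 2 * (p ^+ 2 * q ^+ 2)).
  by move: a0 b0; lra.
lra.
Qed.

(** With [p = |x - z|], [q = |x - m|] and [c] the product of these two vectors, the gap in the
    supporting-hyperplane inequality of the norm at [x - z] is exactly [(p q - c) / p]. Since
    [p q + c <= 2 p q], it is at least the Gram determinant over [2 p^2 q], and [p <= A + q] removes
    [z] from the denominator. The Gram determinant is the same for the pairs [z - m, x - m] and
    [x - z, x - m]. *)
Lemma gradient_lower_bound (A : R) z x m : 0 < A -> `|z - m| <= A ->
  `|x - z| - `|x - m|
    + gram (z - m) (x - m) * (2 * `|x - m| * (A + `|x - m|) ^+ 2)^-1
  <= - dot (unit_vec (x - z)) (z - m).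
Proof.
move=> A0 zmA.
have h0 : `|x - z| <= A + `|x - m|.
  have -> : x - z = - (z - m) + (x - m) by rewrite opprB [RHS]addrC addrA subrK.
  by apply: le_trans (ler_normD _ _) _; rewrite normrN lerD2r.
have -> : z - m = - ((x - z) - (x - m)) by rewrite opprB opprB [RHS]addrC addrA subrK.
move: (x - z) (x - m) h0 => {}z {}x {m zmA} h0.
rewrite gramC gramNr gramC gramBl // dotNr opprK /unit_vec dotZl dotDr dotNr Hdot.
have := gram_ge0 z x; have := dot_le_norm z x; rewrite /gram.
have := normr_ge0 z; have := normr_ge0 x.
move: h0; set p := `|z|; set q := `|x|; set c := dot z x => pq q0 p0 cpq gr.
(* The sample equals the iterate: the unit vector is 0 because [0^-1 = 0], the Gram determinant
   vanishes, and only [- q <= 0] is left. *)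
have [pz|pn0] := eqVneq p 0.
  have z0 : z = 0 by apply/eqP; rewrite -normr_eq0 -/p pz.
  have -> : c = 0 by rewrite /c z0 -(scale0r (0 : H)) dotZl mul0r.
  by rewrite pz invr0 expr0n/= !mul0r subr0 !mul0r addr0 sub0r oppr_le0.
have {}p0 : 0 < p by rewrite lt_def pn0.
have -> : p^-1 * (p ^+ 2 - c) = p - c / p by field.
have [qz|qn0] := eqVneq q 0.
  have c0 : c = 0.
    apply/eqP; rewrite -sqrf_eq0 eq_le sqr_ge0 andbT.
    by move: gr; rewrite qz expr0n mulr0; lra.
  by rewrite qz c0 mulr0 mul0r invr0 mulr0 addr0 mul0r.
have {}q0 : 0 < q by rewrite lt_def qn0.
rewrite -addrA lerD2l -lerBrDl opprK [leRHS]addrC.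
have -> : q - c / p = (p * q - c) / p by field.
apply: (@le_trans _ _ ((p * q - c) * (2 * (p * q)) / (2 * q * (A + q) ^+ 2))).
  rewrite ler_wpM2r ?invr_ge0 ?(mulr_ge0, exprn_ge0, addr_ge0, ltW q0, ltW A0)//.
  have -> : p ^+ 2 * q ^+ 2 - c ^+ 2 = (p * q - c) * (p * q + c) by ring.
  by rewrite ler_wpM2l//; lra.
have -> : (p * q - c) * (2 * (p * q)) / (2 * q * (A + q) ^+ 2)
    = (p * q - c) * (p / (A + q) ^+ 2).
  have Aq : A + q != 0 by rewrite gt_eqF// addr_gt0.
  by field; rewrite qn0 Aq.
rewrite ler_wpM2l ?subr_ge0// ler_pdivrMr ?exprn_gt0 ?addr_gt0//.
by rewrite mulrC ler_pdivlMr// -expr2 ler_sqr// nnegrE ltW// addr_gt0.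
Qed.

End inner_product.

(** * Borel measurability in a separable space *)

Section borel_measurability.
Context (R : realType) (H : completeNormedModType R) (Hsep : separable H).
Context (d : measure_display) (S : measurableType d).
Implicit Types (f g : S -> borel H).

Lemma dense_sequence : exists e : nat -> H,
  forall (x : H) (r : R), 0 < r -> exists i, `|x - e i| < r.
Proof.
have [D cD dD] := Hsep.
have h (x : H) (r : R) : 0 < r -> exists2 y, D y & `|x - y| < r.
  move=> r0; have [|y [By Dy]] := dD (ball x r) _ (ball_open x r).
    by exists x; exact: ballxx.
  by exists y => //; rewrite -ball_normE in By.
have [D0|[e]] := pfcard_geP cD.
  by have [y] := h 0 1 ltr01; rewrite D0.
exists e => x r /(h x)[y Dy xy].
by have [n _ en] := 'surj_e Dy; exists n; rewrite en.
Qed.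

Lemma measurable_borelP f : measurable_fun setT f <->
  forall U : set H, open U -> measurable (f @^-1` U).
Proof.
split=> [mf U oU|mf].
  by rewrite -[_ @^-1` _]setTI; apply: mf => //; exact: sub_sigma_algebra.
apply: (@measurability _ _ S (borel H) setT f (@open H) erefl) => _ [U oU <-].
by rewrite setTI; exact: mf.
Qed.

Lemma measurable_realP (h : S -> R) :
  (forall U : set R, open U -> measurable (h @^-1` U)) -> measurable_fun setT h.
Proof.
move=> mh; apply: (measurability _ (RGenOpens.measurableE R)).
by move=> _ [_ [a [b ->] <-]]; rewrite setTI; apply: mh; exact: interval_open.
Qed.

(** Here separability matters: an open set of the product is a countable union of products of balls
    centred at the dense sequence, so measurability of each coordinate suffices. *)
Lemma measurable_preimage_open2 (K : topologicalType) (k : H * H -> K) f g :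
  continuous k -> measurable_fun setT f -> measurable_fun setT g ->
  forall U : set K, open U -> measurable ((fun s => k (f s, g s)) @^-1` U).
Proof.
move=> ck /measurable_borelP mf /measurable_borelP mg U oU.
have [e he] := dense_sequence.
pose V (q : nat * nat * nat) := ball (e q.1.1) q.2.+1%:R^-1 : set H.
pose W (q : nat * nat * nat) := ball (e q.1.2) q.2.+1%:R^-1 : set H.
pose I := [set q | V q `*` W q `<=` k @^-1` U].
have -> : (fun s => k (f s, g s)) @^-1` U =
    \bigcup_(q : nat * nat * nat) if q \in I then f @^-1` V q `&` g @^-1` W q else set0.
  apply/seteqP; split=> [s /= Us|s [q _]]; last first.
    by case: ifPn => // /set_mem Iq [fs gs]; exact: (Iq (f s, g s)).
  have : nbhs (f s, g s) (k @^-1` U).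
    by apply: open_nbhs_nbhs; split => //; move/continuousP: ck; exact.
  rewrite -nbhs_ballE => -[r /= r0 hr].
  have [n nr] : exists n : nat, n.+1%:R^-1 < r / 2.
    have [n _ hn] := near_infty_natSinv_lt (PosNum (divr_gt0 r0 (ltr0Sn _ 1))).
    by exists n; apply: hn => /=.
  have n0 : 0 < n.+1%:R^-1 :> R by rewrite invr_gt0.
  have [i hi] := he (f s) _ n0; have [j hj] := he (g s) _ n0.
  have le_r : n.+1%:R^-1 + n.+1%:R^-1 <= r by rewrite (splitr r) ltW// ltrD.
  exists (i, j, n) => //.
  have Vs : V (i, j, n) (f s) by rewrite /V -ball_normE/= distrC.
  have Ws : W (i, j, n) (g s) by rewrite /W -ball_normE/= distrC.
  case: ifPn => //; rewrite notin_setE => -[] [x y] [/= Vx Wy]; apply: hr; split => /=.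
    apply: (le_ball le_r).
    by apply: ball_triangle Vx; exact: ball_sym.
  apply: (le_ball le_r).
  by apply: ball_triangle Wy; exact: ball_sym.
apply: countable_bigcupT_measurable => // q.
case: ifPn => // _; apply: measurableI; [apply: mf|apply: mg]; exact: ball_open.
Qed.

Lemma measurable_comp_continuous (k : H -> borel H) f :
  continuous (k : H -> H) -> measurable_fun setT f -> measurable_fun setT (k \o f).
Proof.
move=> ck /measurable_borelP mf; apply/measurable_borelP => U oU.
by rewrite comp_preimage; apply: mf; move/continuousP: ck; exact.
Qed.

Lemma measurable_borelD f g : measurable_fun setT f -> measurable_fun setT g ->
  measurable_fun setT (fun s => (f s : H) + g s : borel H).
Proof.
move=> mf mg; apply/measurable_borelP => U oU.
apply: (@measurable_preimage_open2 H (fun p : H * H => p.1 + p.2)) => //.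
exact: add_continuous.
Qed.

Lemma measurable_borelN f : measurable_fun setT f ->
  measurable_fun setT (fun s => - (f s : H) : borel H).
Proof.
by move=> mf; apply: (@measurable_comp_continuous -%R) => //; exact: opp_continuous.
Qed.

Lemma measurable_borelB f g : measurable_fun setT f -> measurable_fun setT g ->
  measurable_fun setT (fun s => (f s : H) - g s : borel H).
Proof. by move=> mf mg; apply: measurable_borelD => //; exact: measurable_borelN. Qed.

Lemma measurable_borelZ (c : R) f : measurable_fun setT f ->
  measurable_fun setT (fun s => c *: (f s : H) : borel H).
Proof.
move=> mf; apply: (@measurable_comp_continuous ( *:%R c)) => //.
exact: scaler_continuous.
Qed.

Lemma measurable_borel_norm f : measurable_fun setT f ->
  measurable_fun setT (fun s => `|f s : H|).
Proof.
move=> /measurable_borelP mf; apply: measurable_realP => U oU.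
apply: (mf ((fun x : H => `|x|) @^-1` U)).
by have /continuousP := @norm_continuous _ H; exact.
Qed.

Lemma measurable_dot (dot : {dot H for (@idfun R)}) f g : induces_norm dot ->
  measurable_fun setT f -> measurable_fun setT g ->
  measurable_fun setT (fun s => dot (f s) (g s)).
Proof.
move=> Hdot mf mg; under eq_fun do rewrite (dot_polarization Hdot).
apply: measurable_funM => //; apply: measurable_funB; [apply: measurable_funB|];
  apply: measurable_funX; apply: measurable_borel_norm => //; exact: measurable_borelD.
Qed.

(** The map is continuous away from 0 only; the preimage of an open set is split into an open part
    and, if the set contains the default value 0, the set where [f] vanishes. *)
Lemma measurable_unit_vec f : measurable_fun setT f ->
  measurable_fun setT (fun s => unit_vec (f s : H) : borel H).
Proof.
move=> /measurable_borelP mf; apply/measurable_borelP => U oU.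
have -> : (fun s => unit_vec (f s : H)) @^-1` U =
    f @^-1` ([set x | x != 0] `&` unit_vec (R:=R) (H:=H) @^-1` U) `|`
    (if 0 \in U then ~` (f @^-1` [set x | x != 0]) else set0).
  apply/seteqP; split=> s /=.
    have [f0|f0] := eqVneq (f s : H) 0; last by left.
    rewrite f0 /unit_vec scaler0 => U0; right.
    by rewrite mem_set//= f0 eqxx.
  case=> [[]//|]; case: ifPn => // /set_mem U0 /= /negP; rewrite negbK => /eqP ->.
  by rewrite /unit_vec scaler0.
have o0 : open [set x : H | x != 0].
  rewrite [X in open X](_ : _ = ~` [set 0]); last first.
    by apply/seteqP; split => x /=; move/eqP.
  by apply: closed_openC; exact/accessible_closed_set1/hausdorff_accessible/norm_hausdorff.
apply: measurableU; last by case: ifPn => // _; apply: measurableC; exact: mf.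
apply: mf; rewrite openE => x [/= x0 Ux].
apply: filterI; first exact: open_nbhs_nbhs.
have cu : {for x, continuous (@unit_vec R H)}.
  apply: cvgZ; last exact: cvg_id.
  by apply: cvgV; [rewrite normr_eq0|exact: norm_continuous].
by apply: cu; exact: open_nbhs_nbhs.
Qed.

End borel_measurability.

(** * Coercivity of the drift *)

Section bounded_integrals.
Context (d : measure_display) (T : measurableType d) (R : realType).
Context (P : probability T R).
Implicit Types f g : T -> R.

(** A class stable under linear combinations in which every expectation is a real number;
    confinement to a ball keeps the processes below in it. *)
Definition bounded_measurable f : Prop :=
  measurable_fun setT f /\ exists M, forall w, `|f w| <= M.

Lemma bounded_measurable_integrable f :
  bounded_measurable f -> P.-integrable setT (EFin \o f).
Proof.
move=> [mf [M fM]]; apply: measurable_bounded_integrable => //.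
  by apply: le_lt_trans (ltry 1); exact: probability_le1.
exists M; split; first exact: num_real.
by move=> x Mx w _; exact: le_trans (fM w) (ltW Mx).
Qed.

Lemma bounded_measurableD f g : bounded_measurable f -> bounded_measurable g ->
  bounded_measurable (fun w => f w + g w).
Proof.
move=> [mf [M fM]] [mg [N gN]]; split; first exact: measurable_funD.
by exists (M + N) => w; apply: le_trans (ler_normD _ _) (lerD _ _).
Qed.

Lemma bounded_measurableZ c f : bounded_measurable f ->
  bounded_measurable (fun w => c * f w).
Proof.
move=> [mf [M fM]]; split; first by apply: measurable_funM => //; exact: measurable_cst.
by exists (`|c| * M) => w; rewrite normrM ler_wpM2l.
Qed.

Lemma bounded_measurableB f g : bounded_measurable f -> bounded_measurable g ->
  bounded_measurable (fun w => f w - g w).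
Proof.
move=> bf bg; have := bounded_measurableD bf (bounded_measurableZ (-1) bg).
by under eq_fun do rewrite mulN1r.
Qed.

Lemma bounded_measurable_cst c : bounded_measurable (fun=> c).
Proof. by split; [exact: measurable_cst|exists `|c|]. Qed.

Lemma bounded_measurable_ge0 f M : measurable_fun setT f ->
  (forall w, 0 <= f w <= M) -> bounded_measurable f.
Proof.
by move=> mf fM; split => //; exists M => w; have /andP[f0 ?] := fM w; rewrite ger0_norm.
Qed.

Lemma le_bounded_integral f g : bounded_measurable f -> bounded_measurable g ->
  (forall w, f w <= g w) -> \int[P]_w f w <= \int[P]_w g w.
Proof.
move=> bf bg fg; apply: le_Rintegral => //; exact: bounded_measurable_integrable.
Qed.

Lemma bounded_integralD f g : bounded_measurable f -> bounded_measurable g ->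
  \int[P]_w (f w + g w) = \int[P]_w f w + \int[P]_w g w.
Proof. by move=> bf bg; apply: RintegralD => //; exact: bounded_measurable_integrable. Qed.

Lemma bounded_integralB f g : bounded_measurable f -> bounded_measurable g ->
  \int[P]_w (f w - g w) = \int[P]_w f w - \int[P]_w g w.
Proof. by move=> bf bg; apply: RintegralB => //; exact: bounded_measurable_integrable. Qed.

Lemma bounded_integralZ c f : bounded_measurable f ->
  \int[P]_w (c * f w) = c * \int[P]_w f w.
Proof. by move=> bf; apply: RintegralZl => //; exact: bounded_measurable_integrable. Qed.

Lemma prob_integral_cst c : \int[P]_w (cst c w) = c.
Proof. rewrite Rintegral_cst//= (_ : P setT = 1%E) ?mulr1//; exact: probability_setT.
Qed.

Lemma EFin_bounded_integral f : bounded_measurable f ->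
  ((\int[P]_w f w)%:E = \int[P]_w (f w)%:E)%E.
Proof.
move=> bf; rewrite fineK//; apply: integrable_fin_num => //.
exact: bounded_measurable_integrable.
Qed.

Lemma bounded_integral_eq0 f : bounded_measurable f -> (forall w, 0 <= f w) ->
  \int[P]_w f w = 0 -> {ae P, forall w, f w = 0}.
Proof.
move=> bf f0 f_eq0; have := EFin_bounded_integral bf; rewrite f_eq0 => /esym h.
have mf : measurable_fun setT (EFin \o f) by apply/measurable_EFinP; exact: bf.1.
have := (ae_eq_integral_abs P measurableT mf).1.
rewrite (_ : (fun x => _) = EFin \o f); last first.
  by apply/funext => w /=; rewrite ger0_norm.
move=> /(_ h); apply: filterS => w /= /(_ I)[].
by [].
Qed.

End bounded_integrals.

(** * The form Q, its coercivity under (A1), and the drift inequality *)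

Section coercivity.
Context (R : realType) (H : completeNormedModType R).
Context (dot : {dot H for (@idfun R)}) (Hdot : induces_norm dot).
Context (Hsep : separable H).
Context (d : measure_display) (T : measurableType d) (P : probability T R).
Context (X : {RV P >-> borel H}) (m : H) (A : R) (A0 : 0 < A).

(* The junk value 0 at y = 0 is harmless: the Gram determinant vanishes there. *)
Definition weight (y : H) : R := (2 * `|y| * (A + `|y|) ^+ 2)^-1.

Lemma weight_ge0 y : 0 <= weight y.
Proof. by rewrite invr_ge0 !mulr_ge0// addr_ge0// ltW. Qed.

Lemma weight_gt0 y : y != 0 -> 0 < weight y.
Proof.
rewrite -normr_gt0 => y0.
by rewrite invr_gt0 !mulr_gt0// addr_gt0.
Qed.

(** The weight decays like the inverse cube of the norm, so this product is bounded with no moment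
    of X; the inequality behind it is [A p <= (A + p)^2]. *)
Lemma sqr_norm_weight y : 0 <= `|y| ^+ 2 * weight y <= (2 * A)^-1.
Proof.
rewrite mulr_ge0 ?exprn_ge0 ?weight_ge0//= /weight.
have [->|y0] := eqVneq y 0.
  by rewrite normr0 expr0n mul0r invr_ge0 mulr_ge0// ltW.
have {y0} : 0 < `|y| by rewrite normr_gt0.
move: `|y| => p p0.
rewrite ler_pdivrMr ?mulr_gt0 ?exprn_gt0 ?addr_gt0// ler_pdivlMl ?mulr_gt0//.
have := mulr_gt0 A0 p0; nra.
Qed.

Lemma measurable_weight d' (S : measurableType d') (f : S -> borel H) :
  measurable_fun setT f -> measurable_fun setT (fun s => weight (f s)).
Proof.
move=> mf; have mn : measurable_fun setT (fun s => `|f s : H|).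
  exact: measurable_borel_norm.
(* For a nonnegative argument the inverse, with value 0 at 0, is the power of exponent -1, which is
   measurable across 0 as well. *)
rewrite (_ : (fun s => _) =
    fun s => (2 * `|f s : H| * (A + `|f s : H|) ^+ 2) `^ (-1)); last first.
  apply/funext => s; rewrite powR_inv1//.
  by rewrite !mulr_ge0// addr_ge0// ltW.
apply: (measurableT_comp (measurable_powR _)).
apply: measurable_funM; first exact: measurable_funM.
exact/measurable_funX/measurable_funD.
Qed.

Lemma gram_weight_bound u y : 0 <= gram dot u y * weight y <= `|u| ^+ 2 / (2 * A).
Proof.
rewrite mulr_ge0 ?weight_ge0 ?(gram_ge0 Hdot)//=.
apply: le_trans (_ : `|u| ^+ 2 * `|y| ^+ 2 * weight y <= _).
  by rewrite ler_wpM2r ?weight_ge0 ?gram_le.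
by rewrite -mulrA ler_wpM2l ?exprn_ge0//; have /andP[] := sqr_norm_weight y.
Qed.

Lemma measurable_gram_weight d' (S : measurableType d') (f g : S -> borel H) :
  measurable_fun setT f -> measurable_fun setT g ->
  measurable_fun setT (fun s => gram dot (f s) (g s) * weight (g s)).
Proof.
move=> mf mg; apply: measurable_funM; last exact: measurable_weight.
apply: measurable_funB; last by apply: measurable_funX; exact: measurable_dot.
by apply: measurable_funM; apply: measurable_funX; exact: measurable_borel_norm.
Qed.

Let Y w : borel H := (X w : H) - m.

Let mY : measurable_fun setT Y.
Proof. by apply: measurable_borelB => //; exact: measurable_cst. Qed.

(** The [Q] of the overview. The second derivative of the norm at a nonzero [y] in direction [u] is
    [gram dot u y / |y|^3]; the weight is a minorant of [|y|^-3]. *)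
Definition curvature (u : H) : R := \int[P]_w (gram dot u (Y w) * weight (Y w)).

Let bgram u : bounded_measurable (fun w => gram dot u (Y w) * weight (Y w)).
Proof.
apply: (@bounded_measurable_ge0 _ _ _ _ (`|u| ^+ 2 / (2 * A))).
  by apply: measurable_gram_weight => //; exact: measurable_cst.
by move=> w; exact: gram_weight_bound.
Qed.

Let bsqr : bounded_measurable (fun w => `|Y w : H| ^+ 2 * weight (Y w)).
Proof.
apply: (@bounded_measurable_ge0 _ _ _ _ (2 * A)^-1).
  apply: measurable_funM; last exact: measurable_weight.
  by apply: measurable_funX; exact: measurable_borel_norm.
by move=> w; exact: sqr_norm_weight.
Qed.

Let K := \int[P]_w (`|Y w : H| ^+ 2 * weight (Y w)).

Lemma curvature_ge0 u : 0 <= curvature u.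
Proof. by apply: Rintegral_ge0 => w _; have /andP[] := gram_weight_bound u (Y w). Qed.

Lemma curvature_le u : curvature u <= `|u| ^+ 2 / (2 * A).
Proof.
rewrite -[leRHS](prob_integral_cst P); apply: le_bounded_integral => //.
  exact: bounded_measurable_cst.
by move=> w; have /andP[] := gram_weight_bound u (Y w).
Qed.

(** [gram_sum] at [u], [y], [Y w], weighted and integrated over [w]. The factor [gram dot u y] is
    left over on purpose: once [y] is averaged with the same weight, it becomes [curvature u]
    too. *)
Lemma curvature_compare u y :
  2^-1 * (`|u| ^+ 2 * curvature y) <= `|y| ^+ 2 * curvature u + gram dot u y * K.
Proof.
rewrite /curvature /K mulrA -!bounded_integralZ// -bounded_integralD//; last 2 first.
- exact: bounded_measurableZ.
- exact: bounded_measurableZ.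
apply: le_bounded_integral.
- exact: bounded_measurableZ.
- by apply: bounded_measurableD; exact: bounded_measurableZ.
move=> w; have := gram_sum Hdot u y (Y w).
by move=> /(ler_wpM2r (weight_ge0 (Y w))); lra.
Qed.

Lemma measurable_curvature : measurable_fun setT (curvature \o Y).
Proof.
apply: (@measurableT_comp _ _ _ _ _ _ (@fine R)) => //.
have := @measurable_fun_fubini_tonelli_F _ _ T T R P
  (fun p => (gram dot (Y p.1) (Y p.2) * weight (Y p.2))%:E).
apply.
  apply/measurable_EFinP; apply: measurable_gram_weight.
    exact: (measurableT_comp mY measurable_fst).
  exact: (measurableT_comp mY measurable_snd).
by move=> p; rewrite lee_fin; have /andP[] := gram_weight_bound (Y p.1) (Y p.2).
Qed.

(** Equality in Cauchy-Schwarz makes [x] a multiple of [y]: the vector [|y|^2 x - <y, x> y] has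
    squared norm [|y|^2 * gram dot y x]. *)
Lemma dot_eq0_of_gram y x h : y != 0 -> gram dot y x = 0 -> dot y h = 0 ->
  dot x h = 0.
Proof.
move=> y0 g0 yh.
have : (`|y| ^+ 2) *: x - dot y x *: y = 0.
  apply/eqP; rewrite -normr_eq0 -sqrf_eq0 -[X in X == 0]Hdot !(dotE dot) !(dotC dot x y) !Hdot.
  by move: g0; rewrite /gram => g0; apply/eqP; rewrite -[RHS](mulr0 (`|y| ^+ 2)) -g0; ring.
move=> /(congr1 (fun v => dot v h)); rewrite !(dotE dot) yh mulr0 subr0.
have -> : dot 0 h = 0 by rewrite -(scale0r (0 : H)) dotZl mul0r.
by move/eqP; rewrite mulf_eq0 expf_eq0/= normr_eq0 (negPf y0) => /eqP.
Qed.

Lemma variance_dot_eq0 h : {ae P, forall w, dot (Y w) h = 0} ->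
  'V_P[(fun w => dot (X w : H) h)%R] = 0%E.
Proof.
move=> Yh.
have mX : measurable_fun setT (fun w => dot (X w : H) h).
  by apply: measurable_dot => //; exact: measurable_cst.
have Xh : {ae P, forall w, dot (X w : H) h = dot m h}.
  by apply: filterS Yh => w; rewrite (dotDl dot) (dotNl dot) => /eqP; rewrite subr_eq0 => /eqP.
rewrite /variance unlock expectation.unlock.
have -> : (fine (\int[P]_w (dot (X w : H) h)%:E)%E) = dot m h.
  rewrite (@ae_eq_integral _ _ _ P _ (cst (dot m h)%:E))//.
  - by have := prob_integral_cst P (dot m h).
  - exact/measurable_EFinP.
  - by apply: filterS Xh => w /= -> _.
rewrite (@ae_eq_integral _ _ _ P _ (cst 0%E))//; first by rewrite integral0.
- apply/measurable_EFinP; apply: measurable_funM; apply: measurable_funB => //;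
    exact: measurable_cst.
- apply: filterS Xh => w Xw _; congr EFin.
  change ((dot (X w : H) h - dot m h) * (dot (X w : H) h - dot m h) = 0).
  by rewrite Xw subrr mul0r.
Qed.

Lemma curvature_coercive : assumption_A1 P dot X ->
  exists lambda : R, 0 < lambda /\ forall u, lambda * `|u| ^+ 2 <= curvature u.
Proof.
move=> A1.
have bk : bounded_measurable (fun w => curvature (Y w) * weight (Y w)).
  apply: (@bounded_measurable_ge0 _ _ _ _ ((2 * A)^-1 * (2 * A)^-1)).
    by apply: measurable_funM; [exact: measurable_curvature|exact: measurable_weight].
  move=> w; rewrite mulr_ge0 ?curvature_ge0 ?weight_ge0//=.
  apply: le_trans (ler_wpM2r (weight_ge0 _) (curvature_le _)) _.
  rewrite mulrAC ler_wpM2r ?invr_ge0 ?mulr_ge0 ?(ltW A0)//.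
  by have /andP[] := sqr_norm_weight (Y w).
pose kappa := \int[P]_w (curvature (Y w) * weight (Y w)).
have k0 : 0 <= kappa.
  by apply: Rintegral_ge0 => w _; rewrite mulr_ge0 ?curvature_ge0 ?weight_ge0.
have K0 : 0 <= K.
  by apply: Rintegral_ge0 => w _; have /andP[] := sqr_norm_weight (Y w).
(* Both terms on the right of [curvature_compare] average to [K * curvature u]. *)
have main u : 2^-1 * `|u| ^+ 2 * kappa <= 2 * K * curvature u.
  rewrite /kappa -bounded_integralZ//.
  apply: (@le_trans _ _ (\int[P]_w (curvature u * (`|Y w : H| ^+ 2 * weight (Y w))
      + K * (gram dot u (Y w) * weight (Y w))))).
    apply: le_bounded_integral; first exact: bounded_measurableZ.
      by apply: bounded_measurableD; exact: bounded_measurableZ.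
    move=> w; have /(ler_wpM2r (weight_ge0 (Y w))) := curvature_compare u (Y w).
    lra.
  rewrite bounded_integralD ?bounded_integralZ//; try exact: bounded_measurableZ.
  by rewrite -/K -/(curvature u); lra.
suff k_gt0 : 0 < kappa.
  (* [K + 1] in place of [K] keeps the denominator positive without a separate argument. *)
  exists (kappa / (4 * (K + 1))); split.
    by rewrite divr_gt0// mulr_gt0// ltr_wpDl.
  move=> u; rewrite mulrAC ler_pdivrMr ?mulr_gt0// ?ltr_wpDl//.
  by have := main u; have := curvature_ge0 u; lra.
rewrite lt_def k0 andbT; apply/eqP => kz.
have ae0 := bounded_integral_eq0 bk (fun w => mulr_ge0 (curvature_ge0 _) (weight_ge0 _)) kz.
(* If [kappa] vanished, either some nonzero value [Y w] would have zero curvature, so that almost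
   every [Y] would lie on the line through [Y w], against (A1) at [Y w]; or [Y] would vanish almost
   surely, against (A1) at 0. *)
have [[w [w0 Yw0]]|noY] := pselect (exists w,
  curvature (Y w) * weight (Y w) = 0 /\ Y w != 0 :> H).
  have cw : curvature (Y w) = 0.
    by move/eqP: w0; rewrite mulf_eq0 (gt_eqF (weight_gt0 Yw0)) orbF => /eqP.
  have [h [Yh Vh]] := A1 (Y w).
  have := bounded_integral_eq0 (bgram (Y w)) _ cw.
  move=> /(_ (fun v => mulr_ge0 (gram_ge0 Hdot _ _) (weight_ge0 _))) gae.
  suff : 'V_P[(fun w => dot (X w : H) h)%R] = 0%E by move=> V0; rewrite V0 ltxx in Vh.
  apply: variance_dot_eq0; apply: filterS gae => v gv.
  have [Yv0|Yv0] := eqVneq (Y v : H) 0.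
    by rewrite Yv0 -(scale0r (0 : H)) dotZl mul0r.
  apply: (dot_eq0_of_gram Yw0) => //.
  by move/eqP: gv; rewrite mulf_eq0 (gt_eqF (weight_gt0 Yv0)) orbF => /eqP.
have [h [_ Vh]] := A1 0.
suff : 'V_P[(fun w => dot (X w : H) h)%R] = 0%E by move=> V0; rewrite V0 ltxx in Vh.
apply: variance_dot_eq0; apply: filterS ae0 => v gv.
have [Yv0|Yv0] := eqVneq (Y v : H) 0.
  by rewrite Yv0 -(scale0r (0 : H)) dotZl mul0r.
by exfalso; apply: noY; exists v.
Qed.

Lemma unit_vec_norm_le1 (v : H) : `|unit_vec v| <= 1.
Proof.
have [->|v0] := eqVneq v 0; first by rewrite /unit_vec scaler0 normr0.
by rewrite normrZ normfV normr_id mulVf ?normr_eq0.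
Qed.

Let bounded_dist z : bounded_measurable (fun w => `|(X w : H) - z| - `|X w : H|).
Proof.
split; last first.
  exists `|z| => w; apply: le_trans (ler_dist_dist _ _) _.
  by rewrite addrAC subrr sub0r normrN.
apply: measurable_funB; apply: measurable_borel_norm => //.
by apply: measurable_borelB => //; exact: measurable_cst.
Qed.

Lemma bounded_dot_unit_vec z u :
  bounded_measurable (fun w => dot (unit_vec ((X w : H) - z)) u).
Proof.
split; last first.
  exists `|u| => w; rewrite ler_norml; apply/andP; split.
    rewrite lerNl -dotNr; apply: le_trans (dot_le_norm Hdot _ _) _.
    by rewrite normrN ler_piMl// unit_vec_norm_le1.
  by apply: le_trans (dot_le_norm Hdot _ _) _; rewrite ler_piMl// unit_vec_norm_le1.
apply: measurable_dot => //.
by apply: measurable_unit_vec => //; apply: measurable_borelB.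
Qed.

(** Integrate [gradient_lower_bound]: minimality of [m] makes the difference of the two distances
    nonnegative in expectation, which leaves the curvature. Subtracting [|X|] from each distance
    keeps the integrands bounded. *)
Lemma drift_le z : geometric_median P X m -> `|z - m| <= A ->
  \int[P]_w dot (unit_vec ((X w : H) - z)) (z - m) <= - curvature (z - m).
Proof.
move=> Hm zA.
have med : \int[P]_w (`|(X w : H) - m| - `|X w : H|) <=
    \int[P]_w (`|(X w : H) - z| - `|X w : H|).
  have := Hm z; rewrite !expectation.unlock.
  by rewrite -!EFin_bounded_integral// lee_fin.
rewrite -lerN2 opprK.
have -> : - (\int[P]_w dot (unit_vec ((X w : H) - z)) (z - m)) =
    \int[P]_w (-1 * dot (unit_vec ((X w : H) - z)) (z - m)).
  by rewrite bounded_integralZ ?mulN1r//; exact: bounded_dot_unit_vec.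
apply: le_trans (_ : _ <= \int[P]_w ((`|(X w : H) - z| - `|X w : H|)
   - (`|(X w : H) - m| - `|X w : H|) + gram dot (z - m) (Y w) * weight (Y w))) _.
  rewrite bounded_integralD//; last exact: bounded_measurableB.
  by rewrite bounded_integralB// lerDr subr_ge0.
apply: le_bounded_integral.
- by apply: bounded_measurableD => //; exact: bounded_measurableB.
- by apply: bounded_measurableZ; exact: bounded_dot_unit_vec.
- move=> w; rewrite mulN1r.
  have := gradient_lower_bound Hdot (X w) A0 zA.
  by rewrite /weight /Y opprB addrA addrNK.
Qed.

End coercivity.

(** * Moments of one step, and deterministic recursions *)

Section power_expansion.
Context (R : realType).
Implicit Types (x y q g s r c : R) (p : nat).

Lemma mul_expr_le x y p : 0 <= x -> 0 <= y -> x * y ^+ p <= x ^+ p.+1 + y ^+ p.+1.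
Proof.
move=> x0 y0; rewrite !exprS.
have xp := exprn_ge0 p x0; have yp := exprn_ge0 p y0.
have [xy|yx] := leP x y.
  by apply: ler_wpDl; [exact: mulr_ge0|exact: ler_wpM2r].
apply: ler_wpDr; first exact: mulr_ge0.
by rewrite ler_wpM2l// lerXn2r ?nnegrE// ltW.
Qed.

(** In the application [r] is the distance to [m], [g] the step size and [s] the product of the
    direction with the displacement. The term linear in [s] must be kept exactly, since its
    expectation is the drift; everything else is absorbed into the two extreme error terms. *)
Lemma expr_perturb p : exists2 D, 0 < D & forall r g s, 0 <= r -> 0 <= g -> `|s| <= r ->
  (r ^+ 2 + 2 * g * s + g ^+ 2) ^+ p.+1 <=
  (r ^+ 2) ^+ p.+1 + 2 * p.+1%:R * g * s * (r ^+ 2) ^+ p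
    + D * (g ^+ 2 * (r ^+ 2) ^+ p + (g ^+ 2) ^+ p.+1).
Proof.
elim: p => [|p [D D0 IH]].
  exists 1 => // r g s r0 g0 sr; rewrite !expr1 !expr0.
  have := sqr_ge0 g; lra.
(* [6 * D] comes from multiplying the old remainder by at most [2 (r^2 + g^2)] and removing mixed
   powers; [6 * p.+1] from the products of the linear term with [2 g s + g^2]; the 2 covers [g^2]
   times the leading power. *)
exists (6 * D + 6 * p.+1%:R + 2).
  by rewrite !addr_gt0// !mulr_gt0.
move=> r g s r0 g0 sr.
have B0 : 0 <= r ^+ 2 + 2 * g * s + g ^+ 2.
  move: sr; rewrite ler_norml => /andP[sr _].
  have := sqr_ge0 (r - g); have := ler_wpM2l g0 sr; rewrite sqrrB; lra.
have s2 : s ^+ 2 <= r ^+ 2 by rewrite -[s ^+ 2]real_normK ?num_real// lerXn2r ?nnegrE.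
have gs : 2 * g * s <= g ^+ 2 + r ^+ 2.
  by have := sqr_ge0 (g - s); rewrite sqrrB; lra.
rewrite exprSr; apply: le_trans (ler_wpM2r B0 (IH r g s r0 g0 sr)) _.
have q0 : 0 <= r ^+ 2 by exact: sqr_ge0.
have G0 : 0 <= g ^+ 2 by exact: sqr_ge0.
have B2 : r ^+ 2 + 2 * g * s + g ^+ 2 <= 2 * (r ^+ 2 + g ^+ 2) by lra.
have h2 := ler_wpM2l G0 (mul_expr_le p q0 G0).
have h3 := ler_wpM2l G0 (mul_expr_le p G0 q0).
rewrite -[p.+2%:R]natr1.
have k0 : 0 <= p.+1%:R :> R by exact: ler0n.
move: (p.+1%:R) k0 => k k0.
rewrite !(exprS _ p.+1) !(exprS _ p) in h2 h3 *.
have Qp : 0 <= (r ^+ 2) ^+ p by exact: exprn_ge0.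
have Gp : 0 <= (g ^+ 2) ^+ p by exact: exprn_ge0.
move: ((r ^+ 2) ^+ p) ((g ^+ 2) ^+ p) Qp Gp h2 h3 => Q W Q0 W0 h2 h3.
have h4 := ler_wpM2l (mulr_ge0 (ltW D0) (addr_ge0 (mulr_ge0 G0 Q0) (mulr_ge0 G0 W0))) B2.
have h5 := ler_wpM2l (mulr_ge0 k0 (mulr_ge0 G0 Q0)) s2.
have h6 := ler_wpM2l (mulr_ge0 k0 (mulr_ge0 G0 Q0)) gs.
have h7 := ler_wpM2l (ltW D0) h2; have h8 := ler_wpM2l (ltW D0) h3.
have h9 := ler_wpM2l k0 h3.
have h10 := mulr_ge0 G0 (mulr_ge0 q0 Q0); have h11 := mulr_ge0 G0 (mulr_ge0 G0 W0).
have h12 := mulr_ge0 k0 h11.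
clear - h4 h5 h6 h7 h8 h9 h10 h11 h12.
lra.
Qed.

Lemma young_expr e p : 0 < e -> exists2 C, 0 <= C & forall g q, 0 <= g -> 0 <= q ->
  g * q ^+ p <= e * q ^+ p.+1 + C * g ^+ p.+1.
Proof.
move=> e0; exists (e ^- p); first by rewrite invr_ge0 exprn_ge0// ltW.
move=> g q g0 q0.
have [ge|eg] := leP g (e * q).
  rewrite ler_wpDr//; first by rewrite mulr_ge0 ?invr_ge0 ?exprn_ge0// ltW.
  by rewrite exprS mulrA ler_wpM2r ?exprn_ge0.
rewrite ler_wpDl//; first by rewrite mulr_ge0 ?exprn_ge0// ltW.
rewrite exprS mulrCA ler_wpM2l// mulrC -expr_div_n lerXn2r ?nnegrE ?divr_ge0 ?(ltW e0)//.
by rewrite ler_pdivlMr// mulrC ltW.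
Qed.

(** Splits the second-order error into a part of size [e * g] times the leading power, small enough
    for the contraction to absorb, and a pure power of the step size. The bound [c] on [g] lowers
    the excess power of [g] to [p.+2]. *)
Lemma expr_perturb_young p e c : 0 < e -> 0 <= c -> exists2 C, 0 <= C &
  forall r g s, 0 <= r -> 0 <= g <= c -> `|s| <= r ->
  (r ^+ 2 + 2 * g * s + g ^+ 2) ^+ p.+1 <=
  (r ^+ 2) ^+ p.+1 + 2 * p.+1%:R * g * s * (r ^+ 2) ^+ p
    + e * g * (r ^+ 2) ^+ p.+1 + C * g ^+ p.+2.
Proof.
move=> e0 c0; have [D D0 hD] := expr_perturb p.
have [C C0 hC] := young_expr p (divr_gt0 e0 D0).
exists (D * C + D * c ^+ p).
  by rewrite addr_ge0// mulr_ge0 ?exprn_ge0// ltW.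
move=> r g s r0 /andP[g0 gc] sr.
apply: le_trans (hD r g s r0 g0 sr) _; rewrite -[leRHS]addrA lerD2l.
have -> : D * (g ^+ 2 * (r ^+ 2) ^+ p + (g ^+ 2) ^+ p.+1) =
    D * g * (g * (r ^+ 2) ^+ p) + D * g ^+ p.+2 * g ^+ p.
  have -> : (g ^+ 2) ^+ p.+1 = g ^+ p.+2 * g ^+ p.
    by rewrite -exprM -exprD mul2n -addnn [in RHS]addSnnS.
  by ring.
have -> : e * g * (r ^+ 2) ^+ p.+1 + (D * C + D * c ^+ p) * g ^+ p.+2 =
    D * g * (e / D * (r ^+ 2) ^+ p.+1 + C * g ^+ p.+1) + D * g ^+ p.+2 * c ^+ p.
  by rewrite (exprS g p.+1); field; rewrite gt_eqF.
apply: lerD.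
  by rewrite ler_wpM2l ?mulr_ge0 ?(ltW D0)// hC// sqr_ge0.
rewrite ler_wpM2l//; first by apply: mulr_ge0; [exact: ltW|exact: exprn_ge0].
by apply: lerXn2r => //; rewrite nnegrE.
Qed.

End power_expansion.

(** * Power sequences and the rate of a contracting recursion *)

Section real_sequences.
Context (R : realType).
Implicit Types (s t alpha : R).

Lemma powRN_mul (x : R) alpha : 0 < x -> x `^ (- alpha) * x = x `^ (1 - alpha).
Proof.
by move=> x0; rewrite addrC powRD ?(gt_eqF x0) ?implybT// powRr1// ltW.
Qed.

(** A discrete integral comparison: [(1 - x)^(-t) = exp (- t ln (1 - x)) >= 1 + t x] at
    [x = 1 / (n + 2)]. *)
Lemma powR_telescope t n : 0 < t ->
  t * n.+2%:R `^ (- (1 + t)) <= n.+1%:R `^ (- t) - n.+2%:R `^ (- t).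
Proof.
move=> t0.
have n1 : 0 < n.+1%:R :> R by rewrite ltr0n.
have n2 : 0 < n.+2%:R :> R by rewrite ltr0n.
have n2n : n.+2%:R != 0 :> R by rewrite gt_eqF.
have -> : n.+2%:R `^ (- (1 + t)) = n.+2%:R `^ (- t) / n.+2%:R :> R.
  rewrite opprD addrC powRD ?n2n ?implybT// powR_inv1//; exact: ltW.
have -> : n.+1%:R = n.+2%:R * (1 + - n.+2%:R^-1) :> R.
  by rewrite mulrDr mulr1 mulrN divff// -[n.+2%:R]natr1 addrK.
have i1 : n.+2%:R^-1 < 1 :> R by rewrite invf_lt1// ltr1n.
rewrite powRM ?subr_ge0 ?(ltW i1) ?(ltW n2)//.
suff : 1 + t / n.+2%:R <= (1 - n.+2%:R^-1) `^ (- t).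
  move=> /(ler_wpM2l (powR_ge0 n.+2%:R (- t))).
  by rewrite mulrDr mulr1 mulrCA -lerBrDl.
rewrite /powR subr_eq0 gt_eqF//; apply: le_trans (expR_ge1Dx _) _.
rewrite ler_expR mulNr -mulrN ler_wpM2l ?(ltW t0)// lerNr.
by apply: le_ln1Dx; rewrite ltrN2.
Qed.

Lemma powR_sum_le s n : 1 < s ->
  \sum_(k < n) k.+1%:R `^ (- s) <= 1 + (s - 1)^-1.
Proof.
move=> s1; have t0 : 0 < s - 1 by rewrite subr_gt0.
case: n => [|n]; first by rewrite big_ord0 addr_ge0// invr_ge0 ltW.
suff : \sum_(k < n.+1) k.+1%:R `^ (- s) <= 1 + (s - 1)^-1 * (1 - n.+1%:R `^ (- (s - 1))).
  move=> /le_trans; apply; rewrite lerD2l ler_piMr ?invr_ge0 ?(ltW t0)//.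
elim: n => [|n IH]; first by rewrite big_ord1 !powR1 subrr mulr0 addr0.
rewrite big_ord_recr/=; apply: le_trans (lerD IH (lexx _)) _.
rewrite -addrA lerD2l -lerBrDl -mulrBr ler_pdivlMl//.
have := powR_telescope n t0; rewrite addrCA subrr addr0.
by lra.
Qed.

(** Equivalent to monotonicity of the power [1 - alpha >= 0], after
    [1 - 1 / (n + 1) <= (n + 1) / (n + 2)]. *)
Lemma powR_neg_ratio alpha n : alpha <= 1 ->
  n.+1%:R `^ (- alpha) * (1 - n.+1%:R^-1) <= n.+2%:R `^ (- alpha) :> R.
Proof.
move=> a1.
have n1 : 0 < n.+1%:R :> R by rewrite ltr0n.
have n2 : 0 < n.+2%:R :> R by rewrite ltr0n.
apply: (@le_trans _ _ (n.+1%:R `^ (- alpha) * (n.+1%:R / n.+2%:R))).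
  rewrite ler_wpM2l ?powR_ge0// ler_pdivlMr// -[n.+2%:R]natr1.
  have -> : (1 - n.+1%:R^-1) * (n.+1%:R + 1) = n.+1%:R - n.+1%:R^-1 :> R.
    by field; rewrite gt_eqF.
  by rewrite gerBl invr_ge0 ltW.
rewrite mulrA ler_pdivrMr//.
rewrite !powRN_mul// ge0_ler_powR ?subr_ge0 ?nnegrE ?ler_nat//; exact: ltW.
Qed.

Lemma powR_ge_near alpha (M : R) : alpha < 1 -> exists N, forall n, (N <= n)%N ->
  M * n.+1%:R^-1 <= n.+1%:R `^ (- alpha) :> R.
Proof.
move=> a1; have b0 : 0 < 1 - alpha by rewrite subr_gt0.
pose M1 := Num.max M 1; have M0 : 0 < M1 by rewrite lt_max ltr01 orbT.
exists (Num.truncn (M1 `^ (1 - alpha)^-1)).+1 => n Nn.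
have n1 : 0 < n.+1%:R :> R by rewrite ltr0n.
rewrite ler_pdivrMr//.
rewrite powRN_mul//.
apply: (@le_trans _ _ M1); first by rewrite le_max lexx.
have -> : M1 = (M1 `^ (1 - alpha)^-1) `^ (1 - alpha).
  by rewrite -powRrM mulVf ?gt_eqF// powRr1// ltW.
rewrite ge0_ler_powR ?(ltW b0) ?nnegrE ?powR_ge0 ?(ltW n1)//.
apply: le_trans (ltW (truncnS_gt _)) _.
by rewrite ler_nat; exact: leqW.
Qed.

Lemma powR_neg_cvg0 alpha e : 0 < alpha -> 0 < e -> exists N, forall n, (N <= n)%N ->
  n.+1%:R `^ (- alpha) <= e :> R.
Proof.
move=> a0 e0.
exists (Num.truncn (e^-1 `^ alpha^-1)).+1 => n Nn.
have n1 : 0 < n.+1%:R :> R by rewrite ltr0n.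
rewrite powRN -[e]invrK lef_pV2 ?posrE ?invr_gt0 ?powR_gt0//.
have -> : e^-1 = (e^-1 `^ alpha^-1) `^ alpha.
  by rewrite -powRrM mulVf ?gt_eqF// powRr1// invr_ge0 ltW.
rewrite ge0_ler_powR ?(ltW a0) ?nnegrE ?powR_ge0 ?(ltW n1)//.
apply: le_trans (ltW (truncnS_gt _)) _.
by rewrite ler_nat; exact: leqW.
Qed.

Lemma bernoulli_le (x : R) p : 0 <= x <= 1 -> 1 - p%:R * x <= (1 - x) ^+ p.
Proof.
move=> /andP[x0 x1]; elim: p => [|p IH]; first by rewrite mul0r subr0 expr0.
rewrite exprS; apply: le_trans (_ : _ <= (1 - x) * (1 - p%:R * x)) _.
  rewrite -natr1; have : 0 <= p%:R * (x * x) by rewrite !mulr_ge0.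
  by lra.
by rewrite ler_wpM2l// subr_ge0.
Qed.

(* The exponent 1 - alpha > 0 makes the contraction 1 - c n^-alpha stronger than the
   decay p / n of n^(-alpha p), so the latter is a supersolution of the recursion. *)
Lemma recursion_rate (a : nat -> R) alpha c C B p : 0 < alpha < 1 -> 0 < c ->
  (forall n, 0 <= a n <= B) ->
  (forall n, c * n.+1%:R `^ (- alpha) <= 1 ->
     a n.+1 <= (1 - c * n.+1%:R `^ (- alpha)) * a n + C * (n.+1%:R `^ (- alpha)) ^+ p.+1) ->
  exists K, forall n, a n <= K * (n.+1%:R `^ (- alpha)) ^+ p.
Proof.
move=> /andP[alpha0 alpha1] c0 aB rec.
have [N1 hN1] := powR_neg_cvg0 alpha0 (@divr_gt0 R 1 c ltr01 c0).
(* From [N2] on, half of the contraction, [c x / 2], is at least [p / (n + 1)], the relative decay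
   of the supersolution. *)
have [N2 hN2] := powR_ge_near (2 * p%:R / c) alpha1.
pose N := maxn N1 N2; pose y n := (n.+1%:R `^ (- alpha) : R) ^+ p.
have y0 n : 0 < y n by rewrite exprn_gt0// powR_gt0.
have B0 : 0 <= B by have /andP[/le_trans h /h] := aB 0%N.
(* The first summand gives [C <= K c / 2], so half of the contraction pays for the noise; the second
   makes the bound hold for all [n <= N]. *)
pose K := `|2 * C / c| + B / y N.
have K0 : 0 <= K by rewrite addr_ge0// divr_ge0// ltW.
have ymono i j : (i <= j)%N -> y j <= y i.
  move=> ij; rewrite lerXn2r ?nnegrE ?powR_ge0// !powRN lef_pV2 ?posrE ?powR_gt0//.
  by rewrite ge0_ler_powR ?(ltW alpha0) ?nnegrE// ler_nat.
have init n : (n <= N)%N -> a n <= K * y n.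
  move=> nN; have /andP[_ anB] := aB n; apply: le_trans anB _.
  rewrite mulrDl ler_wpDl//; first by rewrite mulr_ge0// ltW.
  by rewrite mulrAC ler_pdivlMr// ler_wpM2l// ymono.
have step n : (N <= n)%N -> a n <= K * y n -> a n.+1 <= K * y n.+1.
  rewrite geq_max => /andP[/hN1 h1 /hN2 h2] an.
  pose x : R := n.+1%:R `^ (- alpha); rewrite -/x in h1 h2.
  have x0 : 0 < x by rewrite powR_gt0.
  have cx : c * x <= 1 by rewrite mulrC -ler_pdivlMr.
  apply: le_trans (rec n cx) _; rewrite -/x exprS -/(y n).
  have Cc : C <= K * c / 2.
    have CK : 2 * C / c <= K by rewrite (le_trans (ler_norm _))// lerDl divr_ge0// ltW.
    by move: CK; rewrite ler_pdivrMr//; lra.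
  apply: (@le_trans _ _ (K * (y n * (1 - c * x / 2)))).
    have := ler_wpM2r (mulr_ge0 (ltW x0) (ltW (y0 n))) Cc.
    have : 0 <= 1 - c * x by rewrite subr_ge0.
    by move=> /ler_wpM2l /(_ _ _ an); lra.
  rewrite ler_wpM2l//.
  have n0 : 0 < n.+1%:R :> R by rewrite ltr0n.
  have u01 : 0 <= (n.+1%:R^-1 : R) <= 1 by rewrite invr_ge0 ltW//= invf_le1// ler1n.
  apply: (@le_trans _ _ (y n * (1 - n.+1%:R^-1) ^+ p)).
    rewrite ler_wpM2l ?(ltW (y0 n))//; apply: le_trans (bernoulli_le p u01).
    rewrite lerD2l lerN2; move: (n.+1%:R^-1) (p%:R) h2 => u k.
    by rewrite mulrAC ler_pdivrMr//; lra.
  rewrite /y -exprMn; apply: lerXn2r; last exact/powR_neg_ratio/ltW.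
    by rewrite nnegrE mulr_ge0 ?powR_ge0// subr_ge0; have /andP[] := u01.
  by rewrite nnegrE powR_ge0.
exists K; elim=> [|n IH]; first exact: init.
have [nN|Nn] := leqP n.+1 N; first exact: (init n.+1 nN).
exact: (step n Nn IH).
Qed.

End real_sequences.

(** * Moments after one step from a deterministic point *)

Section one_step.
Context (R : realType) (H : completeNormedModType R).
Context (dot : {dot H for (@idfun R)}) (Hdot : induces_norm dot).
Context (Hsep : separable H).
Context (d : measure_display) (T : measurableType d) (P : probability T R).
Context (X : {RV P >-> borel H}) (m : H) (A : R) (A0 : 0 < A).
Context (HA1 : assumption_A1 P dot X) (Hm : geometric_median P X m).

Implicit Types (g a b : R) (x z u v : H) (p : nat).

Definition sgd_step (g : R) (z x : H) : H := z + g *: unit_vec (x - z).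

Lemma sqr_norm_sgd_step g z x : 0 <= g ->
  `|sgd_step g z x - m| ^+ 2 <=
  `|z - m| ^+ 2 + 2 * g * dot (unit_vec (x - z)) (z - m) + g ^+ 2.
Proof.
move=> g0.
have -> : sgd_step g z x - m = (z - m) + g *: unit_vec (x - z).
  by rewrite /sgd_step addrAC.
rewrite [leLHS](dot_normD Hdot) (dotZr dot) (dotC dot (z - m)).
rewrite -addrA -[leRHS]addrA lerD2l mulrA lerD2l normrZ exprMn real_normK ?num_real//.
by rewrite ler_piMr ?sqr_ge0// exprn_ile1// unit_vec_norm_le1.
Qed.

Lemma abs_dot_unit_vec v u : `|dot (unit_vec v) u| <= `|u|.
Proof.
have h w : dot (unit_vec v) w <= `|w|.
  by apply: le_trans (dot_le_norm Hdot _ _) _; rewrite ler_piMl// unit_vec_norm_le1.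
by rewrite ler_norml lerNl -dotNr h -(normrN u) h.
Qed.

Lemma measurable_sgd_step g d' (S : measurableType d') (f h : S -> borel H) :
  measurable_fun setT f -> measurable_fun setT h ->
  measurable_fun setT (fun s => sgd_step g (f s) (h s) : borel H).
Proof.
move=> mf mh; apply: measurable_borelD => //; apply: measurable_borelZ => //.
by apply: measurable_unit_vec => //; exact: measurable_borelB.
Qed.

Lemma measurable_sgd_step_norm g p d' (S : measurableType d') (f h : S -> borel H) :
  measurable_fun setT f -> measurable_fun setT h ->
  measurable_fun setT (fun s => (`|sgd_step g (f s) (h s) - m| ^+ 2) ^+ p).
Proof.
move=> mf mh; apply: measurable_funX; apply: measurable_funX.
apply: measurable_borel_norm => //; apply: measurable_borelB => //.
exact: measurable_sgd_step.
Qed.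

(** The common passage from a pointwise bound, affine with nonnegative slope in the scalar whose
    mean is the drift, to a bound in expectation. *)
Lemma sgd_step_moment_bound g p a b z : 0 <= b ->
  (forall w, (`|sgd_step g z (X w) - m| ^+ 2) ^+ p <=
             a + b * dot (unit_vec ((X w : H) - z)) (z - m)) ->
  `|z - m| <= A ->
  (\int[P]_w ((`|sgd_step g z (X w) - m| ^+ 2) ^+ p)%:E <=
    (a - b * curvature dot X m A (z - m))%:E)%E.
Proof.
move=> b0 hab zA.
have bd := bounded_dot_unit_vec Hdot Hsep X z (z - m).
have bR : bounded_measurable (fun w => a + b * dot (unit_vec ((X w : H) - z)) (z - m)).
  by apply: bounded_measurableD; [exact: bounded_measurable_cst|exact: bounded_measurableZ].
apply: le_trans (_ : _ <= \int[P]_w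
    (a + b * dot (unit_vec ((X w : H) - z)) (z - m))%:E)%E _.
  apply: ge0_le_integral => //.
  - by apply/measurable_EFinP; apply: measurable_sgd_step_norm => //; exact: measurable_cst.
  - by apply/measurable_EFinP; exact: bR.1.
  - by move=> w _; rewrite lee_fin.
rewrite -EFin_bounded_integral// lee_fin.
rewrite bounded_integralD ?bounded_integralZ//; last 2 first.
- exact: bounded_measurable_cst.
- exact: bounded_measurableZ.
rewrite (prob_integral_cst P a) lerD2l -mulrN ler_wpM2l//.
exact: drift_le.
Qed.

Lemma sgd_step_energy g z : 0 <= g -> `|z - m| <= A ->
  (\int[P]_w (`|sgd_step g z (X w) - m| ^+ 2)%:E <= (`|z - m| ^+ 2 + g ^+ 2)%:E)%E.
Proof.
move=> g0 zA.
have := @sgd_step_moment_bound g 1 (`|z - m| ^+ 2 + g ^+ 2) (2 * g) z.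
move=> /(_ _ _ zA) h; apply: le_trans (h _ _) _.
- by rewrite mulr_ge0.
- by move=> w; rewrite expr1; have := sqr_norm_sgd_step z (X w) g0; lra.
- rewrite lee_fin gerBl mulr_ge0 ?mulr_ge0//.
  exact: curvature_ge0.
Qed.

(** The drift supplies [- 2 p.+1 lambda g] times the leading power. As [2 p.+1 >= 2], one [lambda g]
    pays for the Young error, taken with [e = lambda], and at least one more remains. *)
Lemma sgd_step_contraction p cmax : 0 <= cmax -> exists2 lambda, 0 < lambda &
  exists2 C, 0 <= C & forall g z, 0 <= g <= cmax -> `|z - m| <= A ->
  (\int[P]_w ((`|sgd_step g z (X w) - m| ^+ 2) ^+ p.+1)%:E <=
   ((1 - lambda * g) * (`|z - m| ^+ 2) ^+ p.+1 + C * g ^+ p.+2)%:E)%E.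
Proof.
move=> cm0; have [lam [lam0 hlam]] := curvature_coercive Hdot Hsep m A0 HA1.
exists lam => //; have [C C0 hC] := expr_perturb_young p lam0 cm0.
exists C => // g z gc zA; have /andP[g0 _] := gc.
set q := `|z - m| ^+ 2.
have q0 : 0 <= q by exact: exprn_ge0.
have := @sgd_step_moment_bound g p.+1
  (q ^+ p.+1 + lam * g * q ^+ p.+1 + C * g ^+ p.+2)
  (2 * p.+1%:R * g * q ^+ p) z.
move=> /(_ _ _ zA) h; apply: le_trans (h _ _) _.
- by rewrite !mulr_ge0 ?exprn_ge0.
- move=> w.
  apply: le_trans (_ : _ <= (q + 2 * g * dot (unit_vec ((X w : H) - z)) (z - m)
    + g ^+ 2) ^+ p.+1) _.
    have := sqr_norm_sgd_step z (X w) g0; rewrite -/q => hs.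
    by apply: lerXn2r => //; rewrite nnegrE ?exprn_ge0// (le_trans _ hs)// exprn_ge0.
  have := hC `|z - m| g (dot (unit_vec ((X w : H) - z)) (z - m)) (normr_ge0 _) gc
    (abs_dot_unit_vec _ _).
  by rewrite -/q; lra.
- rewrite lee_fin.
  have := hlam (z - m); rewrite -/q => hq.
  have k0 : 0 <= g * q ^+ p by rewrite mulr_ge0// exprn_ge0.
  have k1 : 2 <= 2 * p.+1%:R :> R by rewrite ler_peMr// ler1n.
  have := ler_wpM2l k0 hq; have := mulr_ge0 k0 (mulr_ge0 (ltW lam0) q0).
  have := ler_wpM2r (mulr_ge0 k0 (le_trans (mulr_ge0 (ltW lam0) q0) hq)) k1.
  rewrite (exprS q p); move: (curvature _ _ _ _ _) (p.+1%:R) (q ^+ p) (g ^+ p.+2) => c k Q G.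
  by lra.
Qed.

End one_step.

(** * Independence of the past *)

Section independent_pair.
Local Open Scope ereal_scope.
Context (d : measure_display) (T : measurableType d) (R : realType).
Context (P : probability T R).
Context (d1 d2 : measure_display) (E1 : measurableType d1) (E2 : measurableType d2).

Lemma independent_pair_integral (U : {RV P >-> E1}) (V : {RV P >-> E2})
    (f : E1 * E2 -> \bar R) :
  (forall A B, measurable A -> measurable B ->
     P (U @^-1` A `&` V @^-1` B) = P (U @^-1` A) * P (V @^-1` B)) ->
  measurable_fun setT f -> (forall p, 0 <= f p) ->
  \int[P]_w f (U w, V w) = \int[P]_w \int[P]_v f (U w, V v).
Proof.
move=> indep mf f0.
pose UV w := (U w, V w).
have mUV : measurable_fun setT UV by apply: measurable_fun_pair; exact: measurable_funPT.
pose W : {RV P >-> (E1 * E2)%type} := HB.pack UV (isMeasurableFun.Build _ _ _ _ UV mUV).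
transitivity (\int[distribution P W]_p f p).
  by rewrite ge0_integral_distribution.
transitivity (\int[distribution P U \x distribution P V]_p f p).
  apply: eq_measure_integral => A mA _.
  apply: esym; apply: product_measure_unique => // B C mB mC; exact: indep.
rewrite fubini_tonelli1// ge0_integral_distribution//.
- apply: eq_integral => w _; rewrite /= /fubini_F ge0_integral_distribution//.
  exact: measurableT_comp.
- exact: measurable_fun_fubini_tonelli_F.
- by move=> x; exact: integral_ge0.
Qed.

End independent_pair.

(** * The sigma-algebra of the first n observations *)

Section past.
Context (d : measure_display) (T : measurableType d) (R : realType).
Context (P : probability T R) (d' : measure_display) (E : measurableType d').
Context (Xs : nat -> {RV P >-> E}).
Context (Hindep : mutually_independent [set n : nat | (0 < n)%N] Xs).

Definition cylinder (n : nat) (A : nat -> set E) : set T :=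
  \bigcap_(i in [set i | (0 < i <= n)%N]) (Xs i @^-1` A i).

Definition cylinders (n : nat) : set (set T) :=
  [set cylinder n A | A in [set A | forall i, measurable (A i)]].

(** The sigma-algebra of [Xs 1, ..., Xs n], as another measurable structure on the carrier of [T]:
    being adapted is measurability out of [past n]. Its generators are closed under intersection, as
    uniqueness of measures requires. *)
Definition past (n : nat) := g_sigma_algebraType (cylinders n).

Let iota_set n : [set` [fset i in iota 1 n]%fset] = [set i | (0 < i <= n)%N].
Proof. by apply/seteqP; split => i /=; rewrite !inE/= mem_iota add1n ltnS. Qed.

Lemma cylinder_measurable n A : (forall i, measurable (A i)) -> measurable (cylinder n A).
Proof.
move=> mA; rewrite /cylinder -iota_set.
by apply: fin_bigcap_measurable => // i _; rewrite -[_ @^-1` _]setTI; exact: measurable_funPT.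
Qed.

Lemma cylinders_setI n : setI_closed (cylinders n).
Proof.
move=> _ _ [A mA <-] [B mB <-]; exists (fun i => A i `&` B i).
  by move=> i; exact: measurableI.
by rewrite /cylinder -bigcapI.
Qed.

Lemma cylindersT n : cylinders n setT.
Proof.
exists (fun=> setT) => //; rewrite /cylinder.
by apply/seteqP; split.
Qed.

Lemma probability_cylinder n A : (forall i, measurable (A i)) ->
  P (cylinder n A) = (\prod_(i <- [fset i in iota 1 n]%fset) P (Xs i @^-1` A i))%E.
Proof.
move=> mA; rewrite /cylinder -iota_set Hindep//.
by rewrite iota_set => i /= /andP[].
Qed.

Lemma probability_cylinderS n A B : (forall i, measurable (A i)) -> measurable B ->
  P (cylinder n A `&` Xs n.+1 @^-1` B) = (P (Xs n.+1 @^-1` B) * P (cylinder n A))%E.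
Proof.
move=> mA mB.
pose A' i := if i == n.+1 then B else A i.
have -> : cylinder n A `&` Xs n.+1 @^-1` B = cylinder n.+1 A'.
  apply/seteqP; split => w /=.
    move=> [Aw Bw] i /= /andP[i0]; rewrite /A'; case: eqVneq => [->//|ni ile].
    by apply: Aw; rewrite /= i0 -ltnS ltn_neqAle ni.
  move=> Aw; split; last by have := Aw n.+1; rewrite /A' eqxx /= ltnSn; exact.
  move=> i /= /andP[i0 ile]; have := Aw i; rewrite /A' ltn_eqF ?ltnS//=; apply.
  by rewrite i0 ltnW.
have mA' i : measurable (A' i) by rewrite /A'; case: eqP.
rewrite !probability_cylinder//.
have -> : [fset i in iota 1 n.+1]%fset = (n.+1 |` [fset i in iota 1 n])%fset.
  apply/fsetP => i; rewrite !inE/= !mem_iota !add1n !ltnS.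
  by lia.
rewrite big_fsetU1/=; last by rewrite !inE/= mem_iota add1n ltnn andbF.
rewrite {1}/A' eqxx; congr (_ * _)%E.
apply: eq_fbigr => i; rewrite !inE/= mem_iota add1n => /andP[_ ni] _.
by rewrite /A' ltn_eqF.
Qed.

Lemma past_measurable n (S : set T) : measurable (S : set (past n)) -> measurable S.
Proof.
move: S; apply: smallest_sub; first exact: sigma_algebra_measurable.
by move=> _ [A mA <-]; exact: cylinder_measurable.
Qed.

(** For fixed [B] both sides are finite measures in [S]; they agree on the cylinders, hence on the
    sigma-algebra these generate. *)
Lemma past_independent n (S : set T) B : measurable (S : set (past n)) -> measurable B ->
  P (S `&` Xs n.+1 @^-1` B) = (P S * P (Xs n.+1 @^-1` B))%E.
Proof.
move=> mS mB.
have mXB : measurable (Xs n.+1 @^-1` B).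
  by rewrite -[_ @^-1` _]setTI; exact: measurable_funPT.
have PXB : P (Xs n.+1 @^-1` B) \is a fin_num by exact: fin_num_measure.
have fP0 : 0 <= fine (P (Xs n.+1 @^-1` B)) by exact: fine_ge0.
pose m1 := mrestr P mXB.
pose m2 := mscale (NngNum fP0) P.
have m2E D : m2 D = (P (Xs n.+1 @^-1` B) * P D)%E.
  by rewrite /m2 /mscale; congr (_ * _)%E; exact: fineK.
have := @g_sigma_algebra_measure_unique _ _ _ (cylinders n) _ (fun=> setT) _ _ m1 m2.
move=> h; have : m1 S = m2 S.
  apply: h => //.
  - by move=> _ [A mA <-]; exact: cylinder_measurable.
  - by move=> _; exact: cylindersT.
  - by rewrite bigcup_const.
  - exact: cylinders_setI.
  - move=> _ [A mA <-]; transitivity (P (cylinder n A `&` Xs n.+1 @^-1` B)) => //.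
    by rewrite probability_cylinderS//; exact: esym (m2E _).
  - move=> _; apply: (@le_lt_trans _ _ (P ([set: T] `&` Xs n.+1 @^-1` B))) => //.
    apply: le_lt_trans (ltry 1); apply: probability_le1; exact: measurableI.
by move=> m12; apply: etrans m12 _; rewrite muleC; exact: m2E.
Qed.

Lemma measurable_past n k : (0 < k <= n)%N ->
  measurable_fun setT (Xs k : past n -> E).
Proof.
move=> kn _ B mB; rewrite setTI; apply: sub_sigma_algebra.
exists (fun i => if i == k then B else setT) => [i|]; first by case: eqP.
apply/seteqP; split => w /=; first by move=> /(_ k kn); rewrite eqxx.
by move=> Bw i _; case: eqVneq => [->|].
Qed.

Lemma measurable_pastS n d2 (F : measurableType d2) (f : T -> F) :
  measurable_fun setT (f : past n -> F) -> measurable_fun setT (f : past n.+1 -> F).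
Proof.
move=> mf _ B mB; have := mf measurableT B mB; rewrite !setTI.
move: (f @^-1` B); apply: smallest_sub; first exact: smallest_sigma_algebra.
move=> _ [A mA <-]; apply: sub_sigma_algebra.
exists (fun i => if (i <= n)%N then A i else setT) => [i|]; first by case: ifP.
apply/seteqP; split => w /= h i /= /andP[i0 ni].
  by have := h i; rewrite /= ni i0 leqW//; exact.
by case: ifPn => // ini; apply: h; rewrite /= i0.
Qed.

Lemma measurable_of_past n d2 (F : measurableType d2) (f : T -> F) :
  measurable_fun setT (f : past n -> F) -> measurable_fun setT f.
Proof. by move=> mf _ B mB; apply: (@past_measurable n); exact: mf. Qed.

(** Freezing: the past is held fixed while the new observation is integrated out. It does the work
    of a conditional expectation. *)
Lemma past_integral n (d2 : measure_display) (F : measurableType d2) (W : T -> F)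
    (f : F * E -> \bar R) :
  measurable_fun setT (W : past n -> F) -> measurable_fun setT f ->
  (forall p, 0 <= f p)%E ->
  (\int[P]_w f (W w, Xs n.+1 w) = \int[P]_w \int[P]_v f (W w, Xs n.+1 v))%E.
Proof.
move=> mW mf f0; have mWT := measurable_of_past mW.
pose W' : {RV P >-> F} := HB.pack W (isMeasurableFun.Build _ _ _ _ W mWT).
apply: (@independent_pair_integral _ _ _ P _ _ _ _ W' (Xs n.+1)) => // A B mA mB.
by apply: (@past_independent n) => //; rewrite -[_ @^-1` _]setTI; exact: mW.
Qed.

End past.

Lemma same_law_integral (d : measure_display) (T : measurableType d) (R : realType)
    (P : probability T R) (d' : measure_display) (E : measurableType d')
    (U V : {RV P >-> E}) (f : E -> \bar R) :
  same_law U V -> measurable_fun setT f -> (forall x, 0 <= f x)%E ->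
  (\int[P]_w f (U w) = \int[P]_w f (V w))%E.
Proof.
move=> UV mf f0.
transitivity (\int[distribution P U]_x f x)%E; first by rewrite ge0_integral_distribution.
transitivity (\int[distribution P V]_x f x)%E; last by rewrite ge0_integral_distribution.
by apply: eq_measure_integral => A mA _; rewrite /= UV.
Qed.

(** * The stopped process *)

Section stopped_process.
Context (R : realType) (H : completeNormedModType R).
Context (dot : {dot H for (@idfun R)}) (Hdot : induces_norm dot).
Context (Hsep : separable H).
Context (d : measure_display) (T : measurableType d) (P : probability T R).
Context (X : {RV P >-> borel H}) (HA1 : assumption_A1 P dot X).
Context (m : H) (Hm : geometric_median P X m).
Context (gamma : nat -> R) (gamma_max : R).
Context (gamma_bound : forall n, 0 <= gamma n <= gamma_max).
Context (Xs : nat -> {RV P >-> borel H}).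
Context (Hindep : mutually_independent [set n : nat | (0 < n)%N] Xs).
Context (Hlaw : forall n : nat, (0 < n)%N -> same_law (Xs n) X).
Context (Z : nat -> T -> H).
Context (HZ1_meas : sigma_measurable (Xs 1%N : T -> H) (Z 1%N)).
Context (HZ : stochastic_gradient gamma (fun n => Xs n : T -> H) Z).

Lemma stochastic_gradientS n w :
  Z n.+2 w = sgd_step (gamma n.+1) (Z n.+1 w) (Xs n.+2 w).
Proof. exact: HZ. Qed.

Lemma measurable_iterate n :
  measurable_fun setT (Z n.+1 : past Xs n.+1 -> borel H).
Proof.
elim: n => [|n IH].
  move=> _ B mB; have [A mA] := HZ1_meas mB.
  have := @measurable_past _ _ _ _ _ _ Xs 1 1 isT measurableT A mA.
  by move=> hA <-; rewrite setTI.
rewrite (_ : Z n.+2 = fun w => sgd_step (gamma n.+1) (Z n.+1 w) (Xs n.+2 w)); last first.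
  by apply/funext => w; exact: stochastic_gradientS.
apply: (measurable_sgd_step Hsep); first exact: (measurable_pastS IH).
by apply: measurable_past; rewrite leqnn.
Qed.

Context (A : R) (A0 : 0 < A).

(** Index [n] refers to the iterate [Z n.+1], the sequence starting at 1. All iterates so far are
    tested, so that an exit is never undone. *)
Fixpoint confined n w : bool :=
  (if n is n'.+1 then confined n' w else true) && (`|Z n.+1 w - m| <= A).

(* Moving to m on exit, rather than freezing, makes the energy of the stopped
   process vanish after the exit time, so that it satisfies the same recursion. *)
Definition stopped n w : H := if confined n w then Z n.+1 w else m.

Lemma confinedS n w : confined n.+1 w = confined n w && (`|Z n.+2 w - m| <= A).
Proof. by []. Qed.

Lemma stopped_le n w : `|stopped n w - m| <= A.
Proof.
rewrite /stopped; case: ifPn => [|_]; last by rewrite subrr normr0 ltW.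
by case: n => [|n] /andP[].
Qed.

Lemma measurable_confined n :
  measurable_fun setT (confined n : past Xs n.+1 -> bool).
Proof.
have mle k : measurable_fun setT ((fun w => `|Z k.+1 w - m| <= A) : past Xs k.+1 -> bool).
  apply: measurable_fun_ler => //; apply: measurable_borel_norm.
  by apply: measurable_borelB => //; exact: measurable_iterate.
elim: n => [|n IH]; first by apply: measurable_and.
by apply: measurable_and => //; exact: (measurable_pastS IH).
Qed.

Lemma measurable_stopped n :
  measurable_fun setT (stopped n : past Xs n.+1 -> borel H).
Proof.
apply: measurable_fun_ifT => //; [exact: measurable_confined|exact: measurable_iterate].
Qed.

Let measurable_stoppedT n : measurable_fun setT (stopped n : T -> borel H).
Proof. by apply: (@measurable_of_past _ _ _ _ _ _ Xs n.+1); exact: measurable_stopped. Qed.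

Let measurable_confinedT n : measurable_fun setT (confined n).
Proof. by apply: (@measurable_of_past _ _ _ _ _ _ Xs n.+1); exact: measurable_confined. Qed.

Let update n w := sgd_step (gamma n.+1) (stopped n w) (Xs n.+2 w).

Lemma stoppedS_le n p w :
  (`|stopped n.+1 w - m| ^+ 2) ^+ p.+1 <= (`|update n w - m| ^+ 2) ^+ p.+1.
Proof.
rewrite /update {1}/stopped confinedS.
case: ifPn => [/andP[c _]|_]; first by rewrite stochastic_gradientS /stopped c.
by rewrite subrr normr0 expr0n/= expr0n/= !exprn_ge0.
Qed.

(** At the exit step the move to [m] destroys an energy above [A^2], which pays for the indicator
    that appears. Before and after the exit the indicator does not change. *)
Lemma stopped_energyS_le n w :
  `|stopped n.+1 w - m| ^+ 2 + A ^+ 2 * (~~ confined n.+1 w)%:R <=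
  `|update n w - m| ^+ 2 + A ^+ 2 * (~~ confined n w)%:R.
Proof.
have A2 : 0 <= A ^+ 2 by rewrite exprn_ge0// ltW.
rewrite /update /stopped confinedS; case: (confined n w) => /=; last first.
  by rewrite subrr normr0 expr0n/= add0r lerDr exprn_ge0.
rewrite -stochastic_gradientS mulr0 addr0.
have [ZA|ZA] /= := leP `|Z n.+2 w - m| A.
  by rewrite mulr0 addr0.
rewrite subrr normr0 expr0n/= add0r mulr1.
by apply: lerXn2r; rewrite ?nnegrE// ltW.
Qed.

Lemma sgd_step_norm_le g z x : 0 <= g ->
  `|sgd_step g z x - m| <= `|z - m| + g.
Proof.
move=> g0; rewrite /sgd_step addrAC; apply: le_trans (ler_normD _ _) _.
rewrite lerD2l normrZ ger0_norm//.
by rewrite ler_piMr// unit_vec_norm_le1.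
Qed.

Lemma bounded_stopped n p :
  bounded_measurable (fun w => (`|stopped n w - m| ^+ 2) ^+ p).
Proof.
apply: (@bounded_measurable_ge0 _ _ _ _ ((A ^+ 2) ^+ p)).
  apply: measurable_funX; apply: measurable_funX; apply: measurable_borel_norm.
  apply: measurable_borelB => //; exact: measurable_stoppedT.
move=> w; rewrite !exprn_ge0//=.
by do 2 (apply: lerXn2r; rewrite ?nnegrE ?exprn_ge0 ?(ltW A0)//); exact: stopped_le.
Qed.

Lemma bounded_update n p :
  bounded_measurable (fun w => (`|update n w - m| ^+ 2) ^+ p).
Proof.
have /andP[g0 gM] := gamma_bound n.+1.
apply: (@bounded_measurable_ge0 _ _ _ _ (((A + gamma_max) ^+ 2) ^+ p)).
  exact: (measurable_sgd_step_norm Hsep).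
have AM : 0 <= A + gamma_max by rewrite addr_ge0 ?(ltW A0)// (le_trans g0).
move=> w; rewrite !exprn_ge0//=.
do 2 (apply: lerXn2r; rewrite ?nnegrE ?exprn_ge0//).
apply: le_trans (sgd_step_norm_le _ _ g0) _; apply: lerD => //; exact: stopped_le.
Qed.

Lemma bounded_exit n : bounded_measurable (fun w => A ^+ 2 * (~~ confined n w)%:R).
Proof.
apply: bounded_measurableZ; apply: (@bounded_measurable_ge0 _ _ _ _ 1); last first.
  by move=> w; case: (confined n w); rewrite /= ?lexx ?ler01.
rewrite (_ : (fun w => _) = fun w => if confined n w then 0 else 1); last first.
  by apply/funext => w; case: (confined n w).
apply: measurable_fun_ifT => //; exact: measurable_confinedT.
Qed.

(** Turns an estimate for one step from a fixed point into one along the process: [stopped n]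
    depends on the past only, and the new observation is independent of it with the law of [X]. *)
Lemma update_integral_le n p (h : T -> R) : bounded_measurable h ->
  (forall w, (\int[P]_v ((`|sgd_step (gamma n.+1) (stopped n w) (X v) - m| ^+ 2) ^+ p)%:E
     <= (h w)%:E)%E) ->
  \int[P]_w ((`|update n w - m| ^+ 2) ^+ p) <= \int[P]_w h w.
Proof.
move=> bh hle; rewrite -lee_fin !EFin_bounded_integral//; last exact: bounded_update.
pose f (q : borel H * borel H) : \bar R :=
  ((`|sgd_step (gamma n.+1) (q.1 : H) (q.2 : H) - m| ^+ 2) ^+ p)%:E.
have mf : measurable_fun setT f.
  by apply/measurable_EFinP; apply: (measurable_sgd_step_norm Hsep).
have f0 q : (0 <= f q)%E by rewrite lee_fin !exprn_ge0.
have -> : (\int[P]_w ((`|update n w - m| ^+ 2) ^+ p)%:E =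
    \int[P]_w \int[P]_v f (stopped n w : borel H, Xs n.+2 v))%E.
  by rewrite -(past_integral Hindep (@measurable_stopped n) mf f0).
apply: ge0_le_integral => //.
- by move=> w _; exact: integral_ge0.
- have := @measurable_fun_fubini_tonelli_F _ _ (borel H) T R P
    (fun q => f (q.1, Xs n.+2 q.2)).
  move=> mF; apply: (measurableT_comp (mF _ _)) => //.
  + apply: (measurableT_comp mf); apply: measurable_fun_pair => //.
    by apply: (measurableT_comp _ measurable_snd).
- by apply/measurable_EFinP; exact: bh.1.
- move=> w _; apply: le_trans (hle w); rewrite le_eqVlt; apply/orP; left; apply/eqP.
  apply: (@same_law_integral _ _ _ P _ _ (Xs n.+2) X (fun x => f (stopped n w, x))) => //.
  + exact: Hlaw.
  + apply: (measurableT_comp mf); exact: measurable_fun_pair.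
Qed.

Lemma exit_energyS n :
  \int[P]_w (`|stopped n.+1 w - m| ^+ 2 + A ^+ 2 * (~~ confined n.+1 w)%:R) <=
  \int[P]_w (`|stopped n w - m| ^+ 2 + A ^+ 2 * (~~ confined n w)%:R) + gamma n.+1 ^+ 2.
Proof.
have /andP[g0 _] := gamma_bound n.+1.
have bs k : bounded_measurable (fun w => `|stopped k w - m| ^+ 2) := bounded_stopped k 1.
have bu : bounded_measurable (fun w => `|update n w - m| ^+ 2) := bounded_update n 1.
have bc : bounded_measurable (fun _ : T => gamma n.+1 ^+ 2).
  exact: bounded_measurable_cst.
apply: le_trans (le_bounded_integral P _ _ (@stopped_energyS_le n)) _.
- by apply: bounded_measurableD => //; exact: bounded_exit.
- by apply: bounded_measurableD => //; exact: bounded_exit.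
rewrite !bounded_integralD//; try exact: bounded_exit.
rewrite addrAC lerD2r -[X in _ <= _ + X](prob_integral_cst P) -bounded_integralD//.
apply: (@update_integral_le n 1 (fun w => `|stopped n w - m| ^+ 2 + gamma n.+1 ^+ 2)).
  exact: bounded_measurableD.
move=> w; apply: (sgd_step_energy Hdot Hsep A0 Hm g0); exact: stopped_le.
Qed.

(** Its indicator part is [A^2] times the probability of an exit up to [n]; since it grows by at
    most [gamma^2] per step, it plays the part of a maximal inequality. *)
Definition exit_energy n : R :=
  \int[P]_w (`|stopped n w - m| ^+ 2 + A ^+ 2 * (~~ confined n w)%:R).

Lemma exit_energy_le n :
  exit_energy n <= exit_energy 0 + \sum_(k < n) gamma k.+1 ^+ 2.
Proof.
elim: n => [|n IH]; first by rewrite big_ord0 addr0.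
by rewrite big_ord_recr/= addrA; apply: le_trans (exit_energyS n) _; rewrite lerD2r.
Qed.

(** The bound is free of [A]: if the first iterate is already outside the ball, the charge [A^2] is
    at most its squared distance to [m]. *)
Lemma exit_energy0_le (M : R) : {ae P, forall w, `|Z 1 w| <= M} ->
  exit_energy 0 <= (M + `|m|) ^+ 2.
Proof.
move=> ZM.
have be : bounded_measurable (fun w =>
    `|stopped 0 w - m| ^+ 2 + A ^+ 2 * (~~ confined 0 w)%:R).
  by apply: bounded_measurableD; [exact: (bounded_stopped 0 1)|exact: bounded_exit].
rewrite -[leRHS](prob_integral_cst P) -lee_fin !EFin_bounded_integral//; last first.
  exact: bounded_measurable_cst.
have A2 : 0 <= A ^+ 2 by rewrite exprn_ge0// ltW.
apply: ae_ge0_le_integral => //.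
- by move=> w _; rewrite lee_fin; apply: addr_ge0; [exact: exprn_ge0|exact: mulr_ge0].
- by apply/measurable_EFinP; exact: be.1.
- by move=> w _; rewrite lee_fin sqr_ge0.
- by apply/measurable_EFinP; exact: measurable_cst.
apply: filterS ZM => w ZM _; rewrite lee_fin.
have ZmM : `|Z 1 w - m| <= M + `|m|.
  by apply: le_trans (ler_normB _ _) _; rewrite lerD2r.
apply: (@le_trans _ _ (`|Z 1 w - m| ^+ 2)).
  rewrite /stopped /=; have [ZA|ZA] /= := leP `|Z 1 w - m| A.
    by rewrite mulr0 addr0.
  rewrite subrr normr0 expr0n/= add0r mulr1.
  by apply: lerXn2r; rewrite ?nnegrE// ltW.
by apply: lerXn2r; rewrite ?nnegrE// (le_trans _ ZmM).
Qed.

Lemma measurable_exit n : measurable [set w | ~~ confined n w].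
Proof.
have mfalse : measurable [set false] by [].
have := @measurable_confinedT n measurableT _ mfalse.
rewrite setTI (_ : _ @^-1` _ = [set w | ~~ confined n w])//.
by apply/seteqP; split => w /=; case: (confined n w).
Qed.

Lemma exit_probability_le (B : R) : (forall n, exit_energy n <= B) ->
  (P (\bigcup_n [set w | ~~ confined n w]) <= (B / A ^+ 2)%:E)%E.
Proof.
move=> hB; have A2 : 0 < A ^+ 2 by rewrite exprn_gt0.
pose S n := [set w | ~~ confined n w].
have mS n : measurable (S n) by exact: measurable_exit.
have PS n : (P (S n) <= (B / A ^+ 2)%:E)%E.
  have fS : P (S n) \is a fin_num by exact: fin_num_measure.
  rewrite -(fineK fS) lee_fin ler_pdivlMr// mulrC; apply: le_trans (hB n).
  rewrite /exit_energy bounded_integralD; last 2 first.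
  - exact: (bounded_stopped n 1).
  - exact: bounded_exit.
  have -> : A ^+ 2 * fine (P (S n)) = \int[P]_w (A ^+ 2 * (~~ confined n w)%:R).
    have bS : bounded_measurable (\1_(S n) : T -> R).
      apply: (@bounded_measurable_ge0 _ _ _ _ 1) => // w.
      by rewrite indicE; case: (_ \in _); rewrite /= ?lexx ?ler01.
    have e w : (~~ confined n w)%:R = \1_(S n) w :> R.
      rewrite indicE; congr (nat_of_bool _)%:R; apply/idP/idP; first exact: mem_set.
      by move/set_mem.
    under eq_Rintegral do rewrite e.
    rewrite bounded_integralZ//; congr (_ * _).
    by rewrite /Rintegral integral_indic// setIT.
  by rewrite lerDr; apply: Rintegral_ge0 => w _; rewrite exprn_ge0.
have ndS : {homo S : i j / (i <= j)%N >-> (i <= j)%O}.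
  move=> i j ij; rewrite subsetEset => w; rewrite /S /=; apply: contra.
  move: ij => /subnK <-; elim: (j - i)%N => [//|k IH].
  by rewrite addSn confinedS => /andP[/IH].
have mU : measurable (\bigcup_n S n) by exact: bigcupT_measurable.
have cv := nondecreasing_cvg_mu (mu := P) mS mU ndS.
change (P (\bigcup_n S n) <= (B / A ^+ 2)%:E)%E.
rewrite -(cvg_lim _ cv)//; apply: lime_le; first by apply/cvg_ex; eexists; exact: cv.
by apply: nearW => n /=; exact: PS.
Qed.

Definition stopped_moment p n : R := \int[P]_w ((`|stopped n w - m| ^+ 2) ^+ p).

Lemma stopped_moment_bound p n : 0 <= stopped_moment p n <= (A ^+ 2) ^+ p.
Proof.
apply/andP; split; first by apply: Rintegral_ge0 => w _; rewrite !exprn_ge0.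
rewrite -[leRHS](prob_integral_cst P); apply: le_bounded_integral.
- exact: bounded_stopped.
- exact: bounded_measurable_cst.
move=> w; do 2 (apply: lerXn2r; rewrite ?nnegrE ?exprn_ge0 ?(ltW A0)//); exact: stopped_le.
Qed.

Lemma stopped_moment_recursion p : exists2 lambda, 0 < lambda & exists C, forall n,
  stopped_moment p.+1 n.+1 <=
  (1 - lambda * gamma n.+1) * stopped_moment p.+1 n + C * gamma n.+1 ^+ p.+2.
Proof.
have gM0 : 0 <= gamma_max by have /andP[/le_trans h /h] := gamma_bound 0.
have [lam lam0 [C C0 hC]] := sgd_step_contraction Hdot Hsep A0 HA1 Hm p gM0.
exists lam => //; exists C => n.
apply: le_trans (le_bounded_integral P _ _ (@stoppedS_le n p)) _.
- exact: bounded_stopped.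
- exact: bounded_update.
have b1 : bounded_measurable (fun w =>
    (1 - lam * gamma n.+1) * (`|stopped n w - m| ^+ 2) ^+ p.+1).
  by apply: bounded_measurableZ; exact: bounded_stopped.
have b2 : bounded_measurable (fun _ : T => C * gamma n.+1 ^+ p.+2).
  exact: bounded_measurable_cst.
rewrite /stopped_moment -bounded_integralZ; last exact: bounded_stopped.
rewrite -[X in _ <= _ + X](prob_integral_cst P) -bounded_integralD//.
apply: update_integral_le; first exact: bounded_measurableD.
move=> w; apply: hC => //; exact: stopped_le.
Qed.

End stopped_process.

(** By monotone convergence the series has a finite expectation, so it converges on almost every
    path. *)
Lemma ae_cvg0_of_summable_integral (d : measure_display) (T : measurableType d)
    (R : realType) (P : probability T R) (u : nat -> T -> R) (B : R) :
  (forall n, bounded_measurable (u n)) -> (forall n w, 0 <= u n w) ->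
  (forall N, \sum_(n < N) \int[P]_w u n w <= B) ->
  {ae P, forall w, u n w @[n --> \oo] --> 0}.
Proof.
move=> bu u0 sB.
pose f w : \bar R := (\sum_(0 <= n <oo) (u n w)%:E)%E.
have mu n : measurable_fun setT (fun w => (u n w)%:E).
  by apply/measurable_EFinP; exact: (bu n).1.
have f0 w : (0 <= f w)%E by apply: nneseries_ge0 => n _ _; rewrite lee_fin.
have mf : measurable_fun setT f.
  by apply: ge0_emeasurable_sum => // n w _ _; rewrite lee_fin.
have fB : (\int[P]_w f w <= B%:E)%E.
  rewrite /f integral_nneseries//; last by move=> n w _; rewrite lee_fin.
  apply: lime_le.
    by apply: is_cvg_nneseries => n _ _; apply: integral_ge0 => w _; rewrite lee_fin.
  apply: nearW => N; rewrite big_mkord.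
  under eq_bigr do rewrite -EFin_bounded_integral//.
  by rewrite sumEFin lee_fin.
have intf : P.-integrable setT f.
  apply/integrableP; split => //.
  rewrite (eq_integral f); last by move=> w _; rewrite gee0_abs.
  exact: le_lt_trans fB (ltry _).
apply: filterS (integrable_ae measurableT intf) => w /(_ I) ffin.
apply: cvg_series_cvg_0; apply: nondecreasing_is_cvgn.
  by apply: nondecreasing_series => n _ _; exact: u0.
exists (fine (f w)) => _ [N _ <-].
rewrite -lee_fin fineK// /series/= -sumEFin; apply: nneseries_lim_ge => n _ _.
by rewrite lee_fin.
Qed.

(** * Almost sure rate *)

Section almost_sure_rate.
Context (R : realType) (H : completeNormedModType R).
Context (dot : {dot H for (@idfun R)}) (Hdot : induces_norm dot).
Context (Hsep : separable H).
Context (d : measure_display) (T : measurableType d) (P : probability T R).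
Context (X : {RV P >-> borel H}) (HA1 : assumption_A1 P dot X).
Context (m : H) (Hm : geometric_median P X m).
Context (alpha : R) (Halpha : 1 / 2 < alpha < 1) (c : R) (Hc : 0 < c).
Context (Xs : nat -> {RV P >-> borel H}).
Context (Hindep : mutually_independent [set n : nat | (0 < n)%N] Xs).
Context (Hlaw : forall n : nat, (0 < n)%N -> same_law (Xs n) X).
Context (Z : nat -> T -> H).
Context (HZ1_bounded : ae_bounded P (Z 1%N)).
Context (HZ1_meas : sigma_measurable (Xs 1%N : T -> H) (Z 1%N)).
Let gamma (n : nat) : R := c * n%:R `^ (- alpha).
Context (HZ : stochastic_gradient gamma (fun n => Xs n : T -> H) Z).

Let gamma_bound n : 0 <= gamma n <= c.
Proof.
have /andP[a0 _] := Halpha.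
rewrite /gamma mulr_ge0 ?powR_ge0 ?(ltW Hc)//= ler_piMr ?(ltW Hc)//.
(* At index 0 the convention that 0 to a nonzero power is 0 gives the step size 0. *)
case: n => [|n]; first by rewrite powR0// oppr_eq0 gt_eqF//; lra.
rewrite powRN invf_le1 ?powR_gt0//; rewrite -[leLHS](powRr0 n.+1%:R) ler_powR ?ler1n//.
lra.
Qed.

(** [alpha > 1/2] makes the squared step sizes summable, so one constant [B] serves all radii
    [j + 1], and the event of leaving every ball has probability at most [B / (j + 1)^2] for each
    [j]. *)
Lemma ae_confined : {ae P, forall w, exists j, forall n, confined m Z j.+1%:R n w}.
Proof.
have [M ZM] := HZ1_bounded; have /andP[a0 _] := Halpha.
have a1 : 1 < 2 * alpha by lra.
pose B := (M + `|m|) ^+ 2 + c ^+ 2 * (1 + (2 * alpha - 1)^-1).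
pose S j := \bigcup_n [set w | ~~ confined m Z j.+1%:R n w].
have j0 j : 0 < j.+1%:R :> R by rewrite ltr0n.
have mS j : measurable (S j).
  by apply: bigcupT_measurable => n; exact: (measurable_exit Hsep m HZ1_meas HZ).
have PS j : (P (S j) <= (B / j.+1%:R ^+ 2)%:E)%E.
  apply: (exit_probability_le Hsep HZ1_meas HZ (j0 j)) => n.
  apply: le_trans (exit_energy_le Hdot Hsep Hm gamma_bound Hindep Hlaw HZ1_meas HZ (j0 j) n) _.
  apply: lerD; first exact: (exit_energy0_le Hsep m HZ1_meas HZ (j0 j) ZM).
  apply: le_trans (ler_wpM2l (sqr_ge0 c) (powR_sum_le n a1)).
  rewrite mulr_sumr; apply: ler_sum => k _.
  rewrite /gamma exprMn -[X in _ * X <= _](powR_mulrn 2) ?powR_ge0// -powRrM.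
  by rewrite mulNr (mulrC alpha).
have PS0 : P (\bigcap_j S j) = 0%E.
  apply/eqP; rewrite eq_le measure_ge0 andbT; apply/lee_addgt0Pr => e e0.
  rewrite add0e.
  have B0 : 0 <= B.
    rewrite addr_ge0 ?sqr_ge0// mulr_ge0 ?sqr_ge0// addr_ge0// invr_ge0; lra.
  pose j := Num.truncn (B / e).
  apply: (@le_trans _ _ (P (S j))).
    apply: le_measure; rewrite ?inE//; first exact: bigcapT_measurable.
    by move=> w; apply.
  apply: le_trans (PS j) _; rewrite lee_fin ler_pdivrMr ?exprn_gt0//.
  have : B / e <= j.+1%:R by exact: ltW (truncnS_gt _).
  rewrite ler_pdivrMr// => /le_trans; apply; rewrite mulrC ler_wpM2l ?(ltW e0)//.
  by rewrite expr2 ler_peMr// ler1n.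
have mS0 : measurable (\bigcap_j S j) by exact: bigcapT_measurable.
have := (negligibleP P mS0).2 PS0; apply: negligibleS => w /= noj j _.
apply: contrapT => nS; apply: noj; exists j => n.
by apply: contrapT => /negP nc; apply: nS; exists n.
Qed.

Lemma ae_stopped_rate beta (A : R) : beta < alpha -> 0 < A -> exists p,
  {ae P, forall w,
    (n.+1%:R `^ beta * `|stopped m Z A n w - m| ^+ 2) ^+ p.+1 @[n --> \oo] --> (0 : R)}.
Proof.
move=> ba A0; have /andP[a0 a1] := Halpha.
have ab : 0 < alpha - beta by rewrite subr_gt0.
(* The closer [beta] is to [alpha], the higher the moment: [(alpha - beta) * p.+1] has to exceed 1
   for the series to converge, and 2 leaves room. *)
exists (Num.truncn (2 / (alpha - beta))); set p := Num.truncn _.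
have hp : 2 <= (alpha - beta) * p.+1%:R.
  by rewrite mulrC -ler_pdivrMr//; exact: ltW (truncnS_gt _).
have [lam lam0 [C hC]] := stopped_moment_recursion Hdot Hsep HA1 Hm gamma_bound
  Hindep Hlaw HZ1_meas HZ A0 p.
have [||||K hK] := @recursion_rate R (stopped_moment P m Z A p.+1) alpha (lam * c)
  (C * c ^+ p.+2) ((A ^+ 2) ^+ p.+1) p.+1.
- by rewrite a1 andbT; lra.
- exact: mulr_gt0.
- by move=> n; apply: (stopped_moment_bound Hsep m HZ1_meas HZ A0).
- move=> n _; apply: le_trans (hC n) _.
  by rewrite /gamma exprMn !mulrA.
pose s := (alpha - beta) * p.+1%:R.
have s1 : 1 < s by rewrite /s; lra.
have bst n := bounded_stopped Hsep m HZ1_meas HZ A0 n p.+1.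
apply: (@ae_cvg0_of_summable_integral _ _ _ _ _ (`|K| * (1 + (s - 1)^-1))).
- by move=> n; under eq_fun do rewrite exprMn; exact: bounded_measurableZ.
- by move=> n w; rewrite exprn_ge0// mulr_ge0// powR_ge0.
move=> N; apply: le_trans (ler_wpM2l (normr_ge0 K) (powR_sum_le N s1)).
rewrite mulr_sumr; apply: ler_sum => n _.
under eq_Rintegral do rewrite exprMn.
rewrite bounded_integralZ//.
apply: le_trans (ler_wpM2l (exprn_ge0 _ (powR_ge0 _ _)) (hK n)) _.
have n0 : n.+1%:R != 0 :> R by rewrite pnatr_eq0.
have -> : n.+1%:R `^ (- s) = (n.+1%:R `^ beta) ^+ p.+1 * (n.+1%:R `^ (- alpha)) ^+ p.+1 :> R.
  rewrite -exprMn -powRD ?n0 ?implybT// -powR_mulrn ?powR_ge0// -powRrM.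
  by rewrite /s -mulNr opprB.
by rewrite mulrCA ler_wpM2r ?ler_norm// mulr_ge0 ?exprn_ge0 ?powR_ge0.
Qed.

Lemma ae_rate beta : beta < alpha ->
  {ae P, forall w, forall eps : R, 0 < eps ->
    \forall n \near \oo, n.+1%:R `^ beta * `|Z n.+1 w - m| ^+ 2 <= eps}.
Proof.
move=> ba.
have hj j : {ae P, forall w, exists p,
    (n.+1%:R `^ beta * `|stopped m Z j.+1%:R n w - m| ^+ 2) ^+ p.+1 @[n --> \oo] --> (0 : R)}.
  have [|p hp] := @ae_stopped_rate beta j.+1%:R ba; first by rewrite ltr0n.
  by apply: filterS hp => w hw; exists p.
(* Almost every path remains in one of countably many balls, and there the stopped sequence of that
   ball is the original one. *)
apply: filterS2 ae_confined (ae_foralln hj) => w [j wj] /(_ j)[p wp] eps eps0.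
have e0 : 0 < eps ^+ p.+1 by rewrite exprn_gt0.
have := cvgr_norm_le _ wp => /(_ _ (eps ^+ p.+1)).
rewrite normr0 => /(_ e0); apply: filterS => n.
rewrite /stopped wj ger0_norm ?exprn_ge0 ?mulr_ge0 ?powR_ge0//.
by rewrite ler_pXn2r// nnegrE ?mulr_ge0 ?powR_ge0// ltW.
Qed.

End almost_sure_rate.

Unset Implicit Arguments.

Theorem theorem5p1
    (R : realType)
    (H : completeNormedModType R) (dot : {dot H for (@idfun R)})
    (Hdot : induces_norm dot) (Hsep : separable H)
    (d : measure_display) (T : measurableType d) (P : probability T R)
    (X : {RV P >-> borel H})
    (HA1 : assumption_A1 P dot X) (HA2 : assumption_A2 P (X : T -> H))
    (m : H) (Hm : geometric_median P X m)
    (alpha : R) (Halpha : 1 / 2 < alpha < 1)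
    (c_gamma : R) (Hc : 0 < c_gamma)
    (Xs : nat -> {RV P >-> borel H})
    (Hindep : mutually_independent [set n : nat | (0 < n)%N] Xs)
    (Hlaw : forall n : nat, (0 < n)%N -> same_law (Xs n) X)
    (Z : nat -> T -> H)
    (HZ1_bounded : ae_bounded P (Z 1%N))
    (HZ1_meas : sigma_measurable (Xs 1%N : T -> H) (Z 1%N))
    (HZ : stochastic_gradient (fun n : nat => c_gamma * n%:R `^ (- alpha))
            (fun n => Xs n : T -> H) Z) :
  forall beta : R, beta < alpha ->
    {ae P, forall w : T,
      (fun n : nat => `|Z n w - m|) =o_\oo
      (fun n : nat => 1 / n%:R `^ (beta / 2))}.
Proof.
move=> beta ba.
have h := ae_rate Hdot Hsep HA1 Hm Halpha Hc Hindep Hlaw HZ1_bounded HZ1_meas HZ ba.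
apply: filterS h => w hw; apply/eqoP => eps eps0.
have [N _ hN] := hw (eps ^+ 2) (exprn_gt0 2 eps0).
(* The shift by one passes from [Z n.+1] to [Z n] and excludes the index 0. *)
exists N.+1 => // -[//|n] /= Nn.
have n0 : 0 < n.+1%:R :> R by rewrite ltr0n.
have p0 : 0 < n.+1%:R `^ (beta / 2) :> R by rewrite powR_gt0.
rewrite normr_id div1r gtr0_norm ?invr_gt0// ler_pdivlMr//.
have e0 : 0 <= `|Z n.+1 w - m| * n.+1%:R `^ (beta / 2) by rewrite mulr_ge0// powR_ge0.
(* Squaring turns [n^(beta / 2)] into [n^beta], which is why the rate was used with [eps ^+ 2]. *)
rewrite -(@ler_pXn2r _ 2)// ?nnegrE ?(ltW eps0)//.
rewrite exprMn -[X in _ * X](powR_mulrn 2) ?powR_ge0// -powRrM divfK// mulrC.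
exact: hN.
Qed.
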